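(* Let $M>0$, $n\ge3$, $\ell\ge2$, $\delta\in(0,1)$, let $\mathcal{J}_0$ and $\mathcal{J}_1$ be collections of $n\times n$ interaction matrices of infinity norm bounded by $M$, and let $(x^1,\dots,x^\ell)\sim\Pr_{J_0^*,J_1^*,\ell}$ for some $J_0^*\in\mathcal{J}_0$ and $J_1^*\in\mathcal{J}_1$. Then there exists an estimator $(\hat J_0,\hat J_1)$ (a function of $(x^1,\dots,x^\ell)$) such that, with probability at least $1-\delta$, both $\|J_0^*-\hat J_0\|_F$ and $\|J_1^*-\hat J_1\|_F$ are bounded by $$\frac{C(M)}{\sqrt\ell}\sqrt{\log N\Big(\mathcal{J}_0,\|\cdot\|_2,\frac1{n\ell}\Big)+\log N\Big(\mathcal{J}_1,\|\cdot\|_2,\frac1{n\ell}\Big)+\log\log n+\log(1/\delta)},$$ where $C(M)$ is a (singly) exponential function of $M$.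
   Context: An interaction matrix is a real symmetric $n\times n$ matrix with zero diagonal. For interaction matrices $J_0,J_1$, $\Pr_{J_0,J_1,\ell}$ is the joint distribution over $x^1,\dots,x^\ell\in\{-1,1\}^n$ given by $$\Pr_{J_0,J_1,\ell}[x^1\cdots x^\ell]\propto\prod_{t=1}^\ell\exp\big(-(x^t)^\top J_0x^t/2\big)\prod_{t=1}^{\ell-1}\exp\big(-(x^t)^\top J_1x^{t+1}/2\big).$$ Norms: $\|J\|_\infty=\max_i\sum_j|J_{ij}|$, $\|\cdot\|_F$ is the Frobenius norm, $\|\cdot\|_2$ is the spectral norm. For a subset $\mathcal{V}$ of a normed space, an $\epsilon$-cover of $\mathcal{V}$ is a set $\mathcal{N}\subseteq\mathcal{V}$ such that every $v\in\mathcal{V}$ has some $u\in\mathcal{N}$ with $\|u-v\|\le\epsilon$; $N(\mathcal{V},\|\cdot\|,\epsilon)$ is the minimum cardinality of an $\epsilon$-cover. ''Singly exponential'' means bounded by $ae^{bM}$ for universal constants $a,b>0$. *)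

(* Defs.v *)
From HB Require Import structures.
From mathcomp Require Import all_boot all_order all_algebra.
From mathcomp Require Import finmap.
From mathcomp Require Import all_classical all_reals all_analysis.

Set Implicit Arguments.
Unset Strict Implicit.
Unset Printing Implicit Defensive.

Import Order.TTheory GRing.Theory Num.Theory.
Local Open Scope classical_set_scope.
Local Open Scope ring_scope.

Definition interaction_matrix (R : realType) (n : nat) (J : 'M[R]_n) : Prop :=
  J^T = J /\ forall i, J i i = 0.

Definition norm_inf (R : realType) (n : nat) (J : 'M[R]_n) : R :=
  \big[Num.max/0]_(i < n) \sum_(j < n) `|J i j|.

Definition norm_F (R : realType) (m n : nat) (A : 'M[R]_(m, n)) : R :=
  Num.sqrt (\sum_(i < m) \sum_(j < n) A i j ^+ 2).

(* On column vectors, [norm_F] is the Euclidean norm. *)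
Definition norm_spec (R : realType) (n : nat) (J : 'M[R]_n) : R :=
  sup [set norm_F (J *m v) | v in [set v : 'cV[R]_n | norm_F v <= 1]].

Definition epsilon_cover (R : realType) (T : zmodType) (nrm : T -> R) (V : set T)
    (eps : R) (N : set T) : Prop :=
  N `<=` V /\ forall v, V v -> exists2 u, N u & nrm (u - v) <= eps.

(* The least cardinality of a finite cover.  The default 0 is only used when
   there is no finite cover; sets of matrices bounded in [norm_inf] are totally
   bounded, hence always have one when eps > 0. *)
Definition covering_number (R : realType) (T : zmodType) (V : set T)
    (nrm : T -> R) (eps : R) : nat :=
  xget 0%N [set k |
    (exists2 N : {fset T}, epsilon_cover nrm V eps [set` N] & #|` N|%fset = k) /\
    (forall N : {fset T}, epsilon_cover nrm V eps [set` N] ->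
       (k <= #|` N|%fset)%N)].

(* Sequences x^1, ..., x^l of spin configurations: the boolean b stands for
   the spin (-1)^b, and time is indexed from 0. *)
Definition trajectory (n l : nat) := {ffun 'I_l -> {ffun 'I_n -> bool}}.

Definition spins (R : realType) (n : nat) (s : {ffun 'I_n -> bool}) : 'cV[R]_n :=
  \col_i (-1) ^+ s i.

Definition bilin (R : realType) (n : nat) (J : 'M[R]_n) (u v : 'cV[R]_n) : R :=
  (u^T *m J *m v) 0 0.

Definition ising_weight (R : realType) (n l : nat) (J0 J1 : 'M[R]_n)
    (x : trajectory n l) : R :=
  (\prod_(t < l) expR (- bilin J0 (spins R (x t)) (spins R (x t)) / 2)) *
  (\prod_(t < l) \prod_(u < l | u == t.+1 :> nat)
     expR (- bilin J1 (spins R (x t)) (spins R (x u)) / 2)).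

Definition ising_pmf (R : realType) (n l : nat) (J0 J1 : 'M[R]_n)
    (x : trajectory n l) : R :=
  ising_weight J0 J1 x / \sum_(y : trajectory n l) ising_weight J0 J1 y.

Definition ising_Pr (R : realType) (n l : nat) (J0 J1 : 'M[R]_n)
    (E : pred (trajectory n l)) : R :=
  \sum_(x : trajectory n l | E x) ising_pmf J0 J1 x.

Definition singly_exponential (R : realType) (C : R -> R) : Prop :=
  exists a b : R, [/\ 0 < a, 0 < b & forall M, 0 < M -> C M <= a * expR (b * M)].

(* Main.v *)
Require Import Defs.
From mathcomp Require Import all_boot all_order all_algebra finmap.
From mathcomp Require Import all_classical all_reals all_analysis.
From mathcomp Require Import ring lra.

(** The estimator is the maximum likelihood estimator restricted to a product of
    two minimal covers.

    Replacing the true pair of matrices by a pair in the covers moves each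
    interaction matrix by at most [1 / (n l)] in spectral norm, hence the
    exponent of the Gibbs weight by at most [1], and every probability by at
    most the factor [e ^ 2] ([ising_pmf_close]).  So one may assume that the
    truth [u] lies in the product of the covers.  The maximizer can be at
    distance more than [r] from [u] only if some [v] at that distance has
    likelihood at least that of [u].  For a fixed [v] this has probability at
    most the Bhattacharyya coefficient of the two laws, which for Gibbs measures
    is [Z_mid / sqrt (Z_u * Z_v)], with [Z_mid] the partition function of the
    average of the two couplings.  A union bound over the covers finishes the
    proof, provided the coefficient is at most [exp (- c l |u - v|_F ^ 2)] with
    [c] of order [exp (- 42 M)] ([ising_likelihood_ratio_error]).

    That estimate is strong convexity of the log-partition function: its second
    derivative in the direction of a coupling [A] is the variance of the energy
    of [A], a quadratic form in the spins, and this variance must be bounded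
    below by a multiple of the squared Frobenius norm of [A]
    ([energy_variance]).  The model is an
    Ising model on time-site pairs whose coupling has row sums at most [2 M].
    For an Ising model with spins [s i], local fields [h i] and row sums at most
    [B], the variable [s i * exp (- s i * h i)] has conditional mean zero given
    the other spins and lies between [exp (- B)] and [exp B] in absolute value.
    For an observable [F] with discrete gradient [phi i], the test variable
    [g = \sum_i phi i * s i * exp (- s i * h i)] has a covariance with [F] of at
    least [exp (- B) * \sum_i E (phi i ^ 2)] ([score_pairing]), whereas its second
    moment is at most [exp (5 B)] times the sum of [\sum_i E (phi i ^ 2)] and the
    squared norm of the Hessian of [F], which is assumed constant
    ([score_second_moment]).  Cauchy-Schwarz then bounds the variance of [F]
    below ([variance_bound]).  For linear [F] the gradient is constant, and the
    result is that a linear form has second moment at least [exp (- 7 B)] times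
    its squared norm.  For quadratic [F] the gradient consists of linear forms,
    whose second moments have just been bounded below. *)

Import Order.TTheory GRing.Theory Num.Theory.
Import numFieldNormedType.Exports.
Local Open Scope classical_set_scope.
Local Open Scope ring_scope.

(** * Finite sums *)

Lemma cauchy_schwarz_weighted {R : realType} {T : finType} (w f g : T -> R) :
  (forall x, 0 <= w x) ->
  (\sum_x w x * (f x * g x)) ^+ 2 <=
  (\sum_x w x * f x ^+ 2) * (\sum_x w x * g x ^+ 2).
Proof.
move=> w0; set a := \sum_x w x * f x ^+ 2; set c := \sum_x w x * g x ^+ 2.
set b := \sum_x _.
have : 0 <= \sum_x \sum_y w x * w y * (f x * g y - f y * g x) ^+ 2.
  apply: sumr_ge0 => x _; apply: sumr_ge0 => y _.
  by rewrite mulr_ge0 ?sqr_ge0// mulr_ge0.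
have -> : \sum_x \sum_y w x * w y * (f x * g y - f y * g x) ^+ 2 =
    a * c - 2 * b ^+ 2 + c * a.
  transitivity (\sum_x \sum_y ((w x * f x ^+ 2) * (w y * g y ^+ 2)
      - 2 * ((w x * (f x * g x)) * (w y * (f y * g y)))
      + (w x * g x ^+ 2) * (w y * f y ^+ 2))).
    by apply: eq_bigr => x _; apply: eq_bigr => y _; ring.
  rewrite /a /b /c expr2 3!big_distrlr/= big_distrr/=.
  rewrite -sumrB -big_split/=; apply: eq_bigr => x _.
  by rewrite big_split/= sumrB big_distrr.
by nra.
Qed.

Lemma cauchy_schwarz {R : realType} {T : finType} (f g : T -> R) :
  (\sum_x f x * g x) ^+ 2 <= (\sum_x f x ^+ 2) * (\sum_x g x ^+ 2).
Proof.
have := cauchy_schwarz_weighted (fun _ : T => 1 : R) f g (fun=> ler01).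
by rewrite !(eq_bigr _ (fun x _ => mul1r _)).
Qed.

Lemma sum_indicator {R : realType} {T : finType} (j : T) (f : T -> R) :
  \sum_k (k == j)%:R * f k = f j.
Proof.
rewrite (bigD1 j)//= eqxx mul1r big1 ?addr0// => k /negbTE ->.
by rewrite mul0r.
Qed.

Lemma sum_prod {R : realType} {T U : finType} (F : T * U -> R) :
  \sum_p F p = \sum_t \sum_u F (t, u).
Proof. by rewrite pair_bigA; apply: eq_bigr => -[]. Qed.

(** * Matrix norms *)

Section Norms.
Context {R : realType}.

Lemma norm_F_ge0 m n (A : 'M[R]_(m, n)) : 0 <= norm_F A.
Proof. exact: sqrtr_ge0. Qed.

Lemma norm_F_sqr m n (A : 'M[R]_(m, n)) :
  norm_F A ^+ 2 = \sum_(i < m) \sum_(j < n) A i j ^+ 2.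
Proof.
by rewrite sqr_sqrtr// sumr_ge0// => i _; apply: sumr_ge0 => j _; exact: sqr_ge0.
Qed.

Lemma norm_F_cV n (v : 'cV[R]_n) : norm_F v ^+ 2 = \sum_i v i 0 ^+ 2.
Proof. by rewrite norm_F_sqr; apply: eq_bigr => i _; rewrite big_ord1. Qed.

Lemma norm_F_triangle m n (A B : 'M[R]_(m, n)) :
  norm_F (A + B) <= norm_F A + norm_F B.
Proof.
rewrite -(@ler_pXn2r _ 2) ?nnegrE ?addr_ge0 ?norm_F_ge0//.
pose ab := \sum_(p : 'I_m * 'I_n) A p.1 p.2 * B p.1 p.2.
have sE (C : 'M[R]_(m, n)) : norm_F C ^+ 2 = \sum_(p : 'I_m * 'I_n) C p.1 p.2 ^+ 2.
  by rewrite norm_F_sqr sum_prod.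
have -> : norm_F (A + B) ^+ 2 = norm_F A ^+ 2 + 2 * ab + norm_F B ^+ 2.
  rewrite !sE /ab mulr_sumr -!big_split/=; apply: eq_bigr => p _.
  by rewrite mxE; ring.
have : ab ^+ 2 <= (norm_F A * norm_F B) ^+ 2.
  by rewrite exprMn !sE; exact: cauchy_schwarz.
rewrite -ler_sqrt ?sqr_ge0// !sqrtr_sqr [X in _ <= X]ger0_norm ?mulr_ge0 ?norm_F_ge0//.
by move=> /(le_trans (ler_norm _)); lra.
Qed.

Lemma norm_F_mulv m n (A : 'M[R]_(m, n)) (v : 'cV[R]_n) :
  norm_F (A *m v) <= norm_F A * norm_F v.
Proof.
rewrite -(@ler_pXn2r _ 2) ?nnegrE ?mulr_ge0 ?norm_F_ge0//.
rewrite exprMn !norm_F_cV norm_F_sqr mulr_suml; apply: ler_sum => i _.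
by rewrite mxE; exact: cauchy_schwarz.
Qed.

Lemma norm_F0 m n : norm_F (0 : 'M[R]_(m, n)) = 0.
Proof.
rewrite /norm_F big1 ?sqrtr0// => i _; rewrite big1// => j _.
by rewrite mxE expr0n.
Qed.

Lemma norm_FZ m n (a : R) (A : 'M[R]_(m, n)) : norm_F (a *: A) = `|a| * norm_F A.
Proof.
rewrite /norm_F -sqrtr_sqr -sqrtrM ?sqr_ge0//; congr (Num.sqrt _).
rewrite mulr_sumr; apply: eq_bigr => i _; rewrite mulr_sumr.
by apply: eq_bigr => j _; rewrite mxE exprMn.
Qed.

Lemma norm_spec_le_F n (A : 'M[R]_n) : norm_spec A <= norm_F A.
Proof.
apply: ge_sup.
  by exists (norm_F (A *m (0 : 'cV[R]_n))), 0 => //=; rewrite norm_F0 ler01.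
move=> _ [v /= v1 <-]; apply: le_trans (norm_F_mulv _ _ _ _) _.
by rewrite -[leRHS]mulr1 ler_wpM2l ?norm_F_ge0.
Qed.

Lemma norm_spec_mulv1 n (A : 'M[R]_n) (v : 'cV[R]_n) :
  norm_F v <= 1 -> norm_F (A *m v) <= norm_spec A.
Proof.
move=> v1; apply: ub_le_sup; last by exists v.
exists (norm_F A) => _ [u /= u1 <-]; apply: le_trans (norm_F_mulv _ _ _ _) _.
by rewrite -[leRHS]mulr1 ler_wpM2l ?norm_F_ge0.
Qed.

Lemma norm_F_le_spec n (A : 'M[R]_n) : norm_F A <= Num.sqrt n%:R * norm_spec A.
Proof.
have s0 : 0 <= norm_spec A.
  by apply: le_trans (norm_spec_mulv1 n A 0 _); rewrite ?norm_F_ge0// norm_F0 ler01.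
rewrite -(@ler_pXn2r _ 2) ?nnegrE ?mulr_ge0 ?sqrtr_ge0 ?norm_F_ge0//.
rewrite exprMn norm_F_sqr sqr_sqrtr ?ler0n// exchange_big/=.
rewrite -[n in n%:R]card_ord mulr_natl -sumr_const; apply: ler_sum => j _.
have -> : \sum_i A i j ^+ 2 = norm_F (A *m (delta_mx j 0 : 'cV[R]_n)) ^+ 2.
  by rewrite norm_F_cV -colE; apply: eq_bigr => i _; rewrite mxE.
rewrite lerXn2r ?nnegrE ?norm_F_ge0// norm_spec_mulv1//.
rewrite -(@ler_pXn2r _ 2) ?nnegrE ?norm_F_ge0 ?ler01// expr1n norm_F_cV.
rewrite (bigD1 j)//= !mxE !eqxx expr1n big1 ?addr0// => i /negbTE ij.
by rewrite mxE ij expr0n.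
Qed.

Lemma norm_F_spins n (s : {ffun 'I_n -> bool}) :
  norm_F (spins R s) = Num.sqrt n%:R.
Proof.
rewrite /norm_F; congr (Num.sqrt _).
rewrite (eq_bigr (fun=> 1)) ?sumr_const ?card_ord// => i _.
by rewrite big_ord1 mxE sqrr_sign.
Qed.

Lemma bilin_le n (A : 'M[R]_n) s s' : (0 < n)%N ->
  `|bilin A (spins R s) (spins R s')| <= n%:R * norm_spec A.
Proof.
move=> n0; have sn : 0 < Num.sqrt n%:R :> R by rewrite sqrtr_gt0 ltr0n.
have bE : bilin A (spins R s) (spins R s') =
    \sum_i spins R s i 0 * (A *m spins R s') i 0.
  by rewrite /bilin -mulmxA mxE; apply: eq_bigr => i _; rewrite mxE.
have h : norm_F (A *m spins R s') <= Num.sqrt n%:R * norm_spec A.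
  have -> : spins R s' = Num.sqrt n%:R *: ((Num.sqrt n%:R)^-1 *: spins R s').
    by rewrite scalerA mulfV ?gt_eqF// scale1r.
  rewrite -scalemxAr norm_FZ (ger0_norm (ltW sn)) ler_wpM2l ?(ltW sn)//.
  apply: norm_spec_mulv1; rewrite norm_FZ norm_F_spins.
  by rewrite ger0_norm ?invr_ge0 ?(ltW sn)// mulVf// lt0r_neq0.
rewrite -[n%:R](@sqr_sqrtr R) ?ler0n// expr2 -mulrA.
apply: (@le_trans _ _ (Num.sqrt n%:R * norm_F (A *m spins R s'))); last first.
  by rewrite ler_wpM2l ?(ltW sn).
rewrite -(norm_F_spins n s) -(@ler_pXn2r _ 2) ?nnegrE ?mulr_ge0 ?norm_F_ge0//.
rewrite real_normK ?num_real// bE exprMn !norm_F_cV.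
exact: cauchy_schwarz.
Qed.

Lemma norm_inf_row {n} (J : 'M[R]_n) i : \sum_j `|J i j| <= norm_inf J.
Proof. exact: (le_bigmax_cond _ (fun i => \sum_j `|J i j|)). Qed.

End Norms.

(** * Variance lower bounds in Ising models *)

Section Ising.
Context {R : realType} {V : finType}.
Implicit Types (x : {ffun V -> bool}) (K A c : V -> V -> R) (i j : V).

Definition spin x i : R := (-1) ^+ x i.

Definition flip i x : {ffun V -> bool} := [ffun j => x j (+) (j == i)].

Definition field K x i : R := \sum_j K i j * spin x j.

Definition energy K x : R := 2^-1 * \sum_i spin x i * field K x i.

Definition gibbs K x : R := expR (energy K x).

Definition coupling K (B : R) :=
  [/\ forall i j, K i j = K j i, forall i, K i i = 0 &
      forall i, \sum_j `|K i j| <= B].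

Lemma spin_sqr x i : spin x i * spin x i = 1.
Proof. by rewrite /spin; case: (x i); rewrite ?expr1 ?mulrNN ?mulr1. Qed.

Lemma spin_norm x i : `|spin x i| = 1.
Proof. by rewrite /spin normrX normrN1 expr1n. Qed.

Lemma spin_flip i x j :
  spin (flip i x) j = spin x j - 2 * (j == i)%:R * spin x j.
Proof.
by rewrite /spin /flip ffunE; case: (x j); case: (j == i) => /=;
  rewrite ?expr0 ?expr1 ?mulr0 ?mul0r ?mulr1 ?subr0//; ring.
Qed.

Lemma spin_flip_same i x : spin (flip i x) i = - spin x i.
Proof. by rewrite spin_flip eqxx mulr1; ring. Qed.

Lemma spin_flip_other i x j : j != i -> spin (flip i x) j = spin x j.
Proof. by move=> /negbTE ji; rewrite spin_flip ji mulr0 mul0r subr0. Qed.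

Lemma flipK i : involutive (flip i).
Proof. by move=> x; apply/ffunP => j; rewrite !ffunE addbK. Qed.

Lemma sum_flip i (F : {ffun V -> bool} -> R) :
  \sum_x F x = \sum_x F (flip i x).
Proof. by rewrite (reindex_inj (inv_inj (flipK i))). Qed.

(** Averaging over the two values of one spin: a weight that does not see that
    spin only sees the mean of the integrand over its two values. *)
Lemma sum_average_flip i (w G H : {ffun V -> bool} -> R) :
  (forall x, w (flip i x) = w x) ->
  (forall x, G x + G (flip i x) = 2 * H x) ->
  \sum_x w x * G x = \sum_x w x * H x.
Proof.
move=> wi GH; apply: (@mulfI _ 2); rewrite ?pnatr_eq0//.
rewrite mulr_natl mulr2n {2}(sum_flip i) -big_split/= mulr_sumr.
by apply: eq_bigr => x _; rewrite wi -mulrDr GH mulrCA.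
Qed.

Lemma field_flip K x i j :
  field K (flip j x) i = field K x i - 2 * K i j * spin x j.
Proof.
rewrite /field (eq_bigr (fun k => K i k * spin x k -
    (k == j)%:R * (2 * K i k * spin x k))).
  by rewrite sumrB sum_indicator.
by move=> k _; rewrite spin_flip; ring.
Qed.

Lemma energy_flip K x i : (forall i j, K i j = K j i) -> (forall i, K i i = 0) ->
  energy K (flip i x) = energy K x - 2 * spin x i * field K x i.
Proof.
move=> Ksym K0.
have E : \sum_k spin (flip i x) k * field K (flip i x) k =
    \sum_k spin x k * field K x k - 4 * spin x i * field K x i.
  rewrite (eq_bigr (fun k => spin x k * field K x k
     - 2 * spin x i * (K i k * spin x k)
     - (k == i)%:R * (2 * spin x k * (field K x k - 2 * K k i * spin x i)))).
    rewrite 2!sumrB -[X in _ - X - _]mulr_sumr -/(field K x i).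
    by rewrite sum_indicator K0; ring.
  by move=> k _; rewrite spin_flip field_flip (Ksym k i); ring.
by rewrite /energy E; field.
Qed.

Lemma gibbs_gt0 K x : 0 < gibbs K x.
Proof. exact: expR_gt0. Qed.

Lemma field_le K B x i : coupling K B -> `|field K x i| <= B.
Proof.
case=> _ _ KB; apply: le_trans (KB i); apply: le_trans (ler_norm_sum _ _ _) _.
by apply: ler_sum => j _; rewrite normrM spin_norm mulr1.
Qed.

Lemma coupling_le K B i j : coupling K B -> `|K i j| <= B.
Proof.
case=> _ _ KB; apply: le_trans (KB i); rewrite (bigD1 j)//= lerDl.
exact: sumr_ge0.
Qed.

Lemma coupling_ge0 K B : coupling K B -> V -> 0 <= B.
Proof. by move=> KB i; apply: le_trans (coupling_le K B i i KB). Qed.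

Definition gibbs_sum K (F : {ffun V -> bool} -> R) : R := \sum_x gibbs K x * F x.

Definition partition_function K : R := \sum_x gibbs K x.

Lemma partition_function_gt0 K : 0 < partition_function K.
Proof.
rewrite /partition_function (bigD1 [ffun=> false])//=.
by rewrite ltr_pwDl ?gibbs_gt0// sumr_ge0// => x _; rewrite ltW// gibbs_gt0.
Qed.

Lemma gibbs_sum_ge0 K F : (forall x, 0 <= F x) -> 0 <= gibbs_sum K F.
Proof. by move=> F0; apply: sumr_ge0 => x _; rewrite mulr_ge0// ltW// gibbs_gt0. Qed.

(** The Gibbs weight depends on the spin at [i] only through the factor
    [exp (spin i * field i)].  Weighting by the inverse of this factor makes the
    spin at [i] an independent fair sign, so the score has conditional mean zero
    given the other spins. *)
Definition score K x i : R := spin x i * expR (- (spin x i * field K x i)).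

Lemma spinM_field_le K B x i : coupling K B ->
  `|spin x i * field K x i| <= B.
Proof. by move=> KB; rewrite normrM spin_norm mul1r; exact: field_le. Qed.

(** [phi] and [c] are the discrete gradient and Hessian of [F] in the spin
    variables; a constant Hessian means that [F] is a polynomial of degree at
    most two. *)
Section QuadraticObservable.
Context {K : V -> V -> R} {B : R} (KB : coupling K B).
Context {F : {ffun V -> bool} -> R} {phi : {ffun V -> bool} -> V -> R}
  {c : V -> V -> R}.
Context (csym : forall i j, c i j = c j i) (c0 : forall i, c i i = 0)
  (dF : forall x i, F x - F (flip i x) = 2 * spin x i * phi x i)
  (dphi : forall x i j, phi (flip j x) i = phi x i - 2 * c i j * spin x j).

Let g x : R := \sum_i phi x i * score K x i.
Let Q : R := \sum_i gibbs_sum K (fun x => phi x i ^+ 2).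
Let C2 : R := partition_function K * \sum_i \sum_j c i j ^+ 2.

Let phi_flip_same x i : phi (flip i x) i = phi x i.
Proof. by rewrite dphi c0 mulr0 mul0r subr0. Qed.

(** Discrete integration by parts: once the weight is independent of the spin at
    [i], averaging over that spin turns [F * spin i] into the partial derivative
    [phi i]. *)
Lemma score_pairing mu :
  expR (- B) * Q <= gibbs_sum K (fun x => (F x - mu) * g x).
Proof.
case: (KB) => Ksym K0 _.
rewrite /gibbs_sum /g.
under [leRHS]eq_bigr do rewrite mulr_sumr mulr_sumr.
rewrite exchange_big/= /Q mulr_sumr; apply: ler_sum => i _.
pose w x := gibbs K x * expR (- (spin x i * field K x i)).
have wi x : w (flip i x) = w x.
  rewrite /w /gibbs -!expRD; congr expR.
  by rewrite energy_flip// spin_flip_same field_flip K0; ring.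
rewrite [leRHS](eq_bigr (fun x => w x * ((F x - mu) * (phi x i * spin x i)))).
  rewrite (sum_average_flip i w _ (fun x => phi x i ^+ 2))//.
    rewrite /gibbs_sum mulr_sumr; apply: ler_sum => x _.
    rewrite mulrA; apply: ler_wpM2r; rewrite ?sqr_ge0// /w mulrC.
    rewrite ler_wpM2l ?(ltW (gibbs_gt0 _ _))// ler_expR lerN2.
    by apply: le_trans (spinM_field_le K B x i KB); exact: ler_norm.
  move=> x; rewrite phi_flip_same spin_flip_same.
  transitivity (phi x i * spin x i * (F x - F (flip i x))); first by ring.
  by rewrite dF; ring: (spin_sqr x i).
by move=> x _; rewrite /w /score; ring.
Qed.

(** Weighting by the two inverse factors removes the spins at [i] and [j] from the
    Gibbs weight, except for their mutual coupling [exp (- K i j * s i * s j)].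
    Without that coupling the expectation of the cross term is the squared
    Hessian entry, because averaging over each spin differentiates once; the
    coupling costs a term proportional to [K i j], and these are summable along
    rows. *)
Lemma score_cross i j : i != j ->
  gibbs_sum K (fun x => (phi x i * score K x i) * (phi x j * score K x j)) <=
  expR (3 * B) * (c i j ^+ 2 * partition_function K) +
  expR (4 * B) * `|K i j| * (2^-1 * gibbs_sum K (fun x => phi x i ^+ 2) +
                             2^-1 * gibbs_sum K (fun x => phi x j ^+ 2)).
Proof.
move=> ij; case: (KB) => Ksym K0 _.
have ji : j != i by rewrite eq_sym.
(* The coupling between the spins at i and j is subtracted by both fields; adding
   it back once gives a weight that sees neither spin. *)
pose w x := expR (energy K x - spin x i * field K x i - spin x j * field K x j
   + K i j * spin x i * spin x j).
have wi x : w (flip i x) = w x.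
  rewrite /w; congr expR; rewrite energy_flip// !spin_flip_same.
  by rewrite !(spin_flip_other _ _ _ ji) !field_flip K0 (Ksym j i); ring.
have wj x : w (flip j x) = w x.
  rewrite /w; congr expR; rewrite energy_flip// !spin_flip_same.
  by rewrite !(spin_flip_other _ _ _ ij) !field_flip K0; ring.
have wle x : w x <= expR (3 * B) * gibbs K x.
  rewrite /w /gibbs -expRD ler_expR.
  have := spinM_field_le K B x i KB; have := spinM_field_le K B x j KB.
  have : `|K i j * spin x i * spin x j| <= B.
    by rewrite !normrM !spin_norm !mulr1 (coupling_le _ _ _ _ KB).
  by rewrite !ler_norml => /andP[? ?] /andP[? ?] /andP[? ?]; lra.
have w_ge0 x : 0 <= w x by exact: expR_ge0.
have B0 : 0 <= B := coupling_ge0 _ _ KB i.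
pose P x := phi x i * phi x j * (spin x i * spin x j).
(* The factor exp (- K i j * s i * s j) is 1 plus a correction of size at most
   |K i j| * exp B. *)
have -> : gibbs_sum K (fun x => (phi x i * score K x i) * (phi x j * score K x j))
   = \sum_x w x * P x +
     \sum_x w x * ((expR (- (K i j * spin x i * spin x j)) - 1) * P x).
  rewrite -big_split/=; apply: eq_bigr => x _.
  have -> : forall a p e : R, a * p + a * ((e - 1) * p) = a * e * p.
    by move=> *; ring.
  rewrite /w -expRD /score /gibbs /P.
  set a := spin x i * field K x i; set b := spin x j * field K x j.
  set d := _ * spin x j.
  have -> : energy K x - a - b + d - d = energy K x + (- a) + (- b) by ring.
  by rewrite !expRD; ring.
apply: lerD.
  rewrite (sum_average_flip i w _ (fun x => c i j * (phi x i * spin x j)))//; last first.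
    move=> x; rewrite /P phi_flip_same spin_flip_same (spin_flip_other _ _ _ ji).
    by rewrite dphi (csym j i); ring: (spin_sqr x i).
  rewrite (sum_average_flip j w _ (fun x => c i j ^+ 2))//; last first.
    by move=> x; rewrite spin_flip_same dphi; ring: (spin_sqr x j).
  rewrite -mulr_suml mulrA [leRHS]mulrAC ler_wpM2r ?sqr_ge0//.
  by rewrite /partition_function mulr_sumr; apply: ler_sum.
rewrite /gibbs_sum !mulr_sumr -big_split/= mulr_sumr; apply: ler_sum => x _.
apply: le_trans (ler_norm _) _; rewrite !normrM !spin_norm !mulr1.
rewrite (ger0_norm (w_ge0 x)).
have H1 : `|expR (- (K i j * spin x i * spin x j)) - 1| <= `|K i j| * expR B.
  have : `|K i j * spin x i * spin x j| = `|K i j|.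
    by rewrite !normrM !spin_norm !mulr1.
  have := coupling_le _ _ i j KB; set k := `|K i j|.
  move: (K i j * _ * _) => t kB tk.
  have := expR_ge1Dx (- t); have := expR_ge1Dx t.
  have e1 : expR (- t) * expR t = 1 by rewrite -expRD addNr expR0.
  have et : expR (- t) <= expR B.
    by rewrite ler_expR (le_trans _ kB)// -tk -normrN ler_norm.
  have eB : 1 <= expR B by rewrite -expR0 ler_expR.
  have := expR_gt0 (- t).
  have : - t <= k by rewrite -tk -normrN ler_norm.
  have : t <= k by rewrite -tk ler_norm.
  move: (expR (- t)) (expR t) (expR B) e1 et eB => u v e uv1 ue e1 ? ? ? ? ?.
  have k0 : 0 <= k by rewrite -tk.
  by rewrite ler_norml; apply/andP; split; nra.
have H2 : `|phi x i| * `|phi x j| <= 2^-1 * phi x i ^+ 2 + 2^-1 * phi x j ^+ 2.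
  have := sqr_ge0 (`|phi x i| - `|phi x j|).
  rewrite -(real_normK (num_real (phi x i))) -(real_normK (num_real (phi x j))).
  by move: `|phi x i| `|phi x j| => u v; lra.
apply: (@le_trans _ _ ((expR (3 * B) * gibbs K x) * ((`|K i j| * expR B) *
    (2^-1 * phi x i ^+ 2 + 2^-1 * phi x j ^+ 2)))).
  by apply: ler_pM => //; apply: ler_pM.
have -> : 4 * B = 3 * B + B by ring.
by rewrite expRD le_eqVlt; apply/orP; left; apply/eqP; ring.
Qed.

Lemma score_second_moment : gibbs_sum K (fun x => g x ^+ 2) <=
  expR (5 * B) * (C2 + Q).
Proof.
have [v _|v0] := pickP (fun _ : V => true); last first.
  have g0 x : g x = 0 by rewrite /g big1// => i _; have := v0 i.
  rewrite [leLHS]big1; last by move=> x _; rewrite g0 expr0n mulr0.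
  rewrite mulr_ge0 ?expR_ge0// addr_ge0//.
    rewrite mulr_ge0 ?(ltW (partition_function_gt0 _))//.
    by apply: sumr_ge0 => i _; apply: sumr_ge0 => j _; exact: sqr_ge0.
  by apply: sumr_ge0 => i _; apply: gibbs_sum_ge0 => x; exact: sqr_ge0.
have B0 : 0 <= B := coupling_ge0 _ _ KB v.
have [q qE] : exists q, forall i, q i = gibbs_sum K (fun x => phi x i ^+ 2).
  by exists (fun i => gibbs_sum K (fun x => phi x i ^+ 2)).
have QE : Q = \sum_i q i by apply: eq_bigr => i _; rewrite qE.
have q0 i : 0 <= q i by rewrite qE; apply: gibbs_sum_ge0 => x; exact: sqr_ge0.
have -> : gibbs_sum K (fun x => g x ^+ 2) = \sum_i \sum_j
    gibbs_sum K (fun x => (phi x i * score K x i) * (phi x j * score K x j)).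
  rewrite /gibbs_sum; under eq_bigr => x _ do
    (rewrite expr2 {1}/g mulr_suml mulr_sumr;
     under eq_bigr => i _ do rewrite mulr_sumr mulr_sumr).
  by rewrite exchange_big/=; apply: eq_bigr => i _; rewrite exchange_big.
have pair i j :
    gibbs_sum K (fun x => (phi x i * score K x i) * (phi x j * score K x j)) <=
    expR (3 * B) * (c i j ^+ 2 * partition_function K) +
    expR (4 * B) * `|K i j| * (2^-1 * q i + 2^-1 * q j) +
    expR (2 * B) * ((j == i)%:R * q i).
  have [->|ij] := eqVneq j i; last first.
    by rewrite mul0r mulr0 addr0 !qE; apply: score_cross; rewrite eq_sym.
  case: KB => _ K0 _; rewrite c0 K0 normr0 expr0n !mul0r !mulr0 mul0r !add0r mul1r.
  rewrite qE /gibbs_sum mulr_sumr; apply: ler_sum => x _.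
  rewrite [leRHS]mulrCA ler_wpM2l ?(ltW (gibbs_gt0 _ _))// /score.
  set e := expR (- _).
  have -> : phi x i * (spin x i * e) * (phi x i * (spin x i * e)) =
      e * e * phi x i ^+ 2 by ring: (spin_sqr x i).
  rewrite ler_wpM2r ?sqr_ge0// -expRD ler_expR.
  by have := spinM_field_le K B x i KB; rewrite ler_norml => /andP[]; lra.
apply: le_trans (ler_sum _ (fun i _ => ler_sum _ (fun j _ => pair i j))) _.
under eq_bigr => i _ do rewrite !big_split/=.
rewrite !big_split/=.
have -> : \sum_i \sum_j expR (3 * B) * (c i j ^+ 2 * partition_function K) =
    expR (3 * B) * C2.
  rewrite /C2 mulr_sumr mulr_sumr; apply: eq_bigr => i _.
  by rewrite mulr_sumr mulr_sumr; apply: eq_bigr => j _; rewrite [partition_function K * _]mulrC.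
have -> : \sum_i \sum_j expR (2 * B) * ((j == i)%:R * q i) = expR (2 * B) * Q.
  rewrite QE mulr_sumr; apply: eq_bigr => i _.
  by rewrite -mulr_sumr sum_indicator.
have row i : \sum_j expR (4 * B) * `|K i j| * q i <= expR (4 * B) * B * q i.
  rewrite -mulr_suml -mulr_sumr ler_wpM2r// ler_wpM2l ?expR_ge0//.
  by case: KB.
have : \sum_i \sum_j expR (4 * B) * `|K i j| * (2^-1 * q i + 2^-1 * q j) <=
    expR (4 * B) * B * Q.
  have -> : \sum_i \sum_j expR (4 * B) * `|K i j| * (2^-1 * q i + 2^-1 * q j) =
      \sum_i \sum_j expR (4 * B) * `|K i j| * q i.
    set X := RHS.
    have XE : \sum_i \sum_j expR (4 * B) * `|K i j| * q j = X.
      rewrite exchange_big; apply: eq_bigr => i _; apply: eq_bigr => j _.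
      by case: KB => -> _ _.
    transitivity (2^-1 * X + 2^-1 * (\sum_i \sum_j expR (4 * B) * `|K i j| * q j)).
      rewrite /X !mulr_sumr -big_split/=; apply: eq_bigr => i _.
      rewrite !mulr_sumr -big_split/=; apply: eq_bigr => j _; by field.
    by rewrite XE; field.
  by rewrite QE mulr_sumr; apply: ler_sum => i _; exact: row.
have C20 : 0 <= C2.
  rewrite mulr_ge0 ?(ltW (partition_function_gt0 _))//.
  by apply: sumr_ge0 => i _; apply: sumr_ge0 => j _; exact: sqr_ge0.
have Q0 : 0 <= Q by rewrite QE; apply: sumr_ge0.
have e35 : expR (3 * B) <= expR (5 * B) by rewrite ler_expR; lra.
have e24 : expR (2 * B) <= expR (4 * B) by rewrite ler_expR; lra.
have e45 : expR (4 * B) * (1 + B) <= expR (5 * B).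
  have -> : 5 * B = 4 * B + B by ring.
  by rewrite expRD ler_wpM2l ?expR_ge0// expR_ge1Dx.
move=> H.
apply: (@le_trans _ _ (expR (5 * B) * C2 + expR (4 * B) * (1 + B) * Q)).
  rewrite -addrA; apply: lerD; first exact: ler_wpM2r.
  by have := ler_wpM2r Q0 e24; move: H; lra.
by rewrite [leRHS]mulrDr lerD2l ler_wpM2r.
Qed.

(** Cauchy-Schwarz for [F - mu] against the test variable [g]. *)
Lemma variance_bound mu :
  expR (- (2 * B)) * Q ^+ 2 <=
  gibbs_sum K (fun x => (F x - mu) ^+ 2) * (expR (5 * B) * (C2 + Q)).
Proof.
have Q0 : 0 <= Q.
  by apply: sumr_ge0 => i _; apply: gibbs_sum_ge0 => x; exact: sqr_ge0.
have cs : gibbs_sum K (fun x => (F x - mu) * g x) ^+ 2 <=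
    gibbs_sum K (fun x => (F x - mu) ^+ 2) * gibbs_sum K (fun x => g x ^+ 2).
  by apply: cauchy_schwarz_weighted => x; rewrite ltW ?gibbs_gt0.
apply: (@le_trans _ _ ((expR (- B) * Q) ^+ 2)).
  have -> : - (2 * B) = - B + - B by ring.
  by rewrite exprMn expRD -expr2.
apply: (@le_trans _ _ (gibbs_sum K (fun x => (F x - mu) * g x) ^+ 2)).
  by rewrite lerXn2r ?nnegrE ?mulr_ge0 ?expR_ge0 ?(le_trans _ (score_pairing mu))
    ?mulr_ge0 ?expR_ge0// score_pairing.
apply: le_trans cs _; apply: ler_wpM2l; last exact: score_second_moment.
by apply: gibbs_sum_ge0 => x; exact: sqr_ge0.
Qed.

End QuadraticObservable.
End Ising.

Section QuadraticVariance.
Context {R : realType} {V : finType} {K : V -> V -> R} {B : R}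
  (KB : coupling K B) (B0 : 0 <= B).

Definition sqnorm (A : V -> V -> R) : R := \sum_i \sum_j A i j ^+ 2.

Lemma sqnorm_ge0 A : 0 <= sqnorm A.
Proof. by apply: sumr_ge0 => i _; apply: sumr_ge0 => j _; exact: sqr_ge0. Qed.

(** The case of constant gradient and zero Hessian. *)
Lemma linear_second_moment (a : V -> R) :
  expR (- (7 * B)) * (partition_function K * \sum_i a i ^+ 2) <=
  gibbs_sum K (fun x => (\sum_i a i * spin x i) ^+ 2).
Proof.
pose F x := \sum_i a i * spin x i.
have dF x i : F x - F (flip i x) = 2 * spin x i * a i.
  rewrite -sumrB (eq_bigr (fun j => (j == i)%:R * (2 * spin x j * a j))).
    by rewrite sum_indicator.
  by move=> j _; rewrite spin_flip; ring.
have dphi (x : {ffun V -> bool}) i j : a i = a i - 2 * 0 * spin x j by ring.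
have := variance_bound KB (fun _ _ : V => erefl (0 : R)) (fun=> erefl) dF dphi 0.
have -> : \sum_i gibbs_sum K (fun _ => a i ^+ 2) = partition_function K * \sum_i a i ^+ 2.
  by rewrite mulr_sumr; apply: eq_bigr => i _; rewrite /gibbs_sum /partition_function mulr_suml.
have -> : \sum_(i : V) \sum_(j : V) (0 : R) ^+ 2 = 0.
  by rewrite big1// => i _; rewrite big1// => j _; rewrite expr0n.
rewrite mulr0 add0r.
have -> : gibbs_sum K (fun x => (F x - 0) ^+ 2) =
    gibbs_sum K (fun x => (\sum_i a i * spin x i) ^+ 2).
  by apply: eq_bigr => x _; rewrite subr0.
set S := _ * \sum_i _ => H.
have : 0 <= S.
  rewrite mulr_ge0 ?(ltW (partition_function_gt0 _))//.
  by apply: sumr_ge0 => i _; exact: sqr_ge0.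
rewrite le_eqVlt => /predU1P[<-|S0].
  by rewrite mulr0; apply: gibbs_sum_ge0 => x; exact: sqr_ge0.
have -> : - (7 * B) = - (2 * B) + - (5 * B) by ring.
rewrite expRD -(ler_pM2r (mulr_gt0 (expR_gt0 (5 * B)) S0)).
apply: le_trans H; rewrite le_eqVlt; apply/orP; left; apply/eqP.
have e : expR (- (5 * B)) * expR (5 * B) = 1 by rewrite -expRD addNr expR0.
by rewrite expr2; ring: e.
Qed.

(** The gradient of the energy of [A] consists of the linear forms [field A], and
    [linear_second_moment] shows that their total second moment [Q] dominates the
    squared norm of the Hessian [A].  Hence the second moment of the test variable
    is of order [Q], while its squared covariance with the energy is of order
    [Q ^ 2]. *)
Lemma energy_variance A mu :
  (forall i j, A i j = A j i) -> (forall i, A i i = 0) ->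
  expR (- (21 * B)) / 2 * sqnorm A * partition_function K <=
  gibbs_sum K (fun x => (energy A x - mu) ^+ 2).
Proof.
move=> Asym A0.
have dE x i : energy A x - energy A (flip i x) = 2 * spin x i * field A x i.
  by rewrite energy_flip//; ring.
have H := variance_bound KB Asym A0 dE (fun x i j => field_flip A x i j) mu.
move: H; set Q := \sum_i gibbs_sum _ _; set S := partition_function K * _.
have SE : sqnorm A * partition_function K = S by rewrite mulrC.
have QS : expR (- (7 * B)) * S <= Q.
  rewrite /S 2!mulr_sumr; apply: ler_sum => i _; exact: linear_second_moment.
set W := gibbs_sum K _ => H.
have W0 : 0 <= W by apply: gibbs_sum_ge0 => x; exact: sqr_ge0.
have S0 : 0 <= S by rewrite -SE mulr_ge0 ?sqnorm_ge0// ltW// partition_function_gt0.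
have Q0 : 0 <= Q by apply: le_trans QS; rewrite mulr_ge0 ?expR_ge0.
rewrite -mulrA SE.
have [Q00|Qn0] := eqVneq Q 0.
  have : S <= 0.
    by rewrite -(pmulr_rle0 _ (expR_gt0 (- (7 * B)))) -Q00.
  move=> S00; have -> : S = 0 by apply/eqP; rewrite eq_le S00.
  by rewrite mulr0.
have Qp : 0 < Q by rewrite lt_def Qn0.
have SQ : S <= expR (7 * B) * Q.
  rewrite -(ler_pM2l (expR_gt0 (- (7 * B)))) [leRHS]mulrA.
  by rewrite -expRD addNr expR0 mul1r.
have e7 : 1 <= expR (7 * B) by rewrite -[leLHS]expR0 ler_expR mulr_ge0.
have WQ : expR (- (2 * B)) * Q <= W * (2 * expR (12 * B)).
  rewrite -(ler_pM2r Qp) -mulrA -expr2; apply: le_trans H _.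
  rewrite -mulrA; apply: ler_wpM2l => //.
  have -> : 12 * B = 5 * B + 7 * B by ring.
  rewrite expRD.
  have -> : 2 * (expR (5 * B) * expR (7 * B)) * Q =
    expR (5 * B) * (2 * expR (7 * B) * Q) by ring.
  by rewrite ler_wpM2l ?expR_ge0//; nra.
rewrite -(ler_pM2r (expR_gt0 (12 * B))) -(@ler_pM2r _ 2)//.
apply: (@le_trans _ _ (expR (- (2 * B)) * Q)); last by move: WQ; lra.
have -> : expR (- (21 * B)) / 2 * S * expR (12 * B) * 2 =
    expR (- (21 * B)) * expR (12 * B) * S by field.
rewrite -expRD.
have -> : - (21 * B) + 12 * B = - (2 * B) + - (7 * B) by ring.
by rewrite expRD -mulrA ler_wpM2l ?expR_ge0.
Qed.

End QuadraticVariance.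

(** * Strong convexity of the log-partition function *)

Lemma is_derive_sum_fin {R : realType} {T : finType} (F : T -> R -> R)
    (dF : T -> R) (s : R) :
  (forall x, is_derive s 1 (F x) (dF x)) ->
  is_derive s 1 (fun s : R => \sum_x F x s) (\sum_x dF x).
Proof.
move=> H; have -> : (fun s : R => \sum_x F x s) = \sum_x F x.
  by apply/funext => t; rewrite fct_sumE.
by apply: (big_ind2 (fun f d => is_derive s 1 f d)) => // *;
  [exact: is_derive_cst|exact: is_deriveD].
Qed.

Section LogPartition.
Context {R : realType} {T : finType} (t0 : T) (h f : T -> R).

Let w s x := expR (h x + s * f x).
Let Z s := \sum_x w s x.
Let Z1 s := \sum_x w s x * f x.
Let Z2 s := \sum_x w s x * f x ^+ 2.

Let Z_gt0 (s : R) : 0 < Z s.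
Proof.
rewrite /Z (bigD1 t0)//= ltr_pwDl ?expR_gt0//.
by apply: sumr_ge0 => x _; exact: expR_ge0.
Qed.

Let w_derive (s : R) x : is_derive s 1 (w ^~ x) (w s x * f x).
Proof.
have d : is_derive s 1 (fun s : R => h x + s * f x) (f x).
  have -> : (fun s : R => h x + s * f x) = cst (h x) + (f x \*: @id R).
    by apply/funext => u; congr (_ + _); exact: mulrC.
  by apply: is_derive_eq; rewrite add0r; exact: mulr1.
exact: (@is_derive1_comp _ expR _ s _ _ (is_derive_expR _) d).
Qed.

Let Z_derive (s : R) : is_derive s 1 Z (Z1 s).
Proof. by apply: is_derive_sum_fin => x; exact: w_derive. Qed.

Let Z1_derive (s : R) : is_derive s 1 Z1 (Z2 s).
Proof.
apply: is_derive_sum_fin => x.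
have -> : (fun s : R => w s x * f x) = f x \*: (w ^~ x).
  by apply/funext => u; exact: mulrC.
by have ? := w_derive s x; apply: is_derive_eq; rewrite /GRing.scale/=; ring.
Qed.

Let lnZ_derive (s : R) : is_derive s 1 (fun s : R => ln (Z s)) (Z1 s / Z s).
Proof.
have := @is_derive1_comp _ (@ln R) Z s _ _ (is_derive1_ln (Z_gt0 s)) (Z_derive s).
by move=> d; apply: is_derive_eq; rewrite mulrC.
Qed.

Let mean_derive (s : R) :
  is_derive s 1 (fun s : R => Z1 s / Z s) (Z2 s / Z s - (Z1 s / Z s) ^+ 2).
Proof.
have dV : is_derive s 1 (fun s : R => (Z s)^-1) (- (Z s) ^- 2 *: Z1 s).
  exact: (@is_deriveV _ Z s _ _ (lt0r_neq0 (Z_gt0 s)) (Z_derive s)).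
have := Z1_derive s => d1.
have -> : (fun s : R => Z1 s / Z s) = Z1 * (fun s : R => (Z s)^-1) by [].
apply: is_derive_eq; rewrite /GRing.scale/=.
by have := lt0r_neq0 (Z_gt0 s) => ?; field.
Qed.

(** The second derivative of [s |-> ln (Z s)] is the variance of [f] under the
    tilted weights, so [ln Z - k s ^ 2 / 2] is convex on [[-1, 1]].  The mean value
    theorem is applied twice: to [(ln Z)'] on [[-s, s]] and to
    [ln (Z s) + ln (Z (- s)) - k s ^ 2] on [[0, 1]]. *)
Lemma log_partition_midpoint (k : R) :
  (forall s mu : R, `|s| <= 1 ->
     k * \sum_x expR (h x + s * f x) <=
     \sum_x expR (h x + s * f x) * (f x - mu) ^+ 2) ->
  k + 2 * ln (\sum_x expR (h x)) <=
  ln (\sum_x expR (h x + f x)) + ln (\sum_x expR (h x - f x)).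
Proof.
move=> var.
have D2 (s : R) : `|s| <= 1 -> k <= Z2 s / Z s - (Z1 s / Z s) ^+ 2.
  move=> s1; rewrite -(ler_pM2r (Z_gt0 s)).
  apply: le_trans (var s (Z1 s / Z s) s1) _.
  rewrite le_eqVlt; apply/orP; left; apply/eqP.
  (* The variance about the mean, with the square expanded. *)
  rewrite (eq_bigr (fun x => w s x * f x ^+ 2 - 2 * (Z1 s / Z s) * (w s x * f x)
     + (Z1 s / Z s) ^+ 2 * w s x)); last by move=> x _; rewrite /w; ring.
  rewrite big_split/= sumrB -!mulr_sumr -/(Z s) -/(Z1 s) -/(Z2 s).
  by have := lt0r_neq0 (Z_gt0 s) => ?; field.
have cont (g dg : R -> R) (a b : R) : (forall s : R, is_derive s 1 g (dg s)) ->
    {within `[a, b], continuous g}.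
  move=> d; apply: derivable_within_continuous => s _.
  by have [] := d s.
pose D (s : R) := Z1 s / Z s.
have incr (s : R) : 0 < s -> s <= 1 -> 2 * k * s <= D s - D (- s).
  move=> s0 s1.
  have [|c + ->] := @MVT R D (fun s : R => Z2 s / Z s - (Z1 s / Z s) ^+ 2) (- s) s _
    (fun u _ => mean_derive u) (cont _ _ _ _ mean_derive); first by lra.
  rewrite in_itv/= => /andP[c1 c2].
  have : `|c| <= 1 by rewrite ler_norml; apply/andP; split; lra.
  by move=> /D2; rewrite opprK; nra.
pose G (s : R) := ln (Z s) + ln (Z (- s)) - k * s ^+ 2.
have G_derive (s : R) : is_derive s 1 G (D s - D (- s) - 2 * k * s).
  have dm : is_derive s 1 (fun s : R => ln (Z (- s))) (D (- s) * -1).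
    have := @is_derive1_comp _ (fun s : R => ln (Z s)) (fun s : R => - s) s _ _
      (lnZ_derive (- s)).
    by apply; exact: (@is_deriveNid R R s 1).
  have d := lnZ_derive s.
  have -> : G = (fun s : R => ln (Z s)) + (fun s : R => ln (Z (- s))) -
      (k \*: (@id R ^+ 2)).
    by apply/funext => u; rewrite /G /= !expr2.
  apply: is_derive_eq; rewrite /GRing.scale/= /D.
  by ring.
have [c + GE] := @MVT R G _ 0 1 ltr01 (fun u _ => G_derive u) (cont _ _ _ _ G_derive).
rewrite in_itv/= => /andP[c0 c1].
have := incr c c0 (ltW c1) => Dc.
have : G 0 <= G 1 by rewrite -subr_ge0 GE subr0 mulr1 subr_ge0.
have -> : \sum_x expR (h x) = Z 0.
  by apply: eq_bigr => x _; rewrite /w mul0r addr0.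
have -> : \sum_x expR (h x + f x) = Z 1.
  by apply: eq_bigr => x _; rewrite /w mul1r.
have -> : \sum_x expR (h x - f x) = Z (- 1).
  by apply: eq_bigr => x _; rewrite /w mulN1r.
by rewrite /G oppr0 expr0n expr1n mulr0 mulr1 subr0; lra.
Qed.

End LogPartition.

Section Affinity.
Context {R : realType} {V : finType}.
Implicit Types (K A : V -> V -> R).

Lemma energy_lin K A (s : R) x :
  energy (fun i j => K i j + s * A i j) x = energy K x + s * energy A x.
Proof.
rewrite /energy [s * _]mulrCA -mulrDr; congr (_ * _).
rewrite mulr_sumr -big_split/=; apply: eq_bigr => i _.
rewrite mulrCA -mulrDr; congr (_ * _).
by rewrite /field mulr_sumr -big_split/=; apply: eq_bigr => j _; ring.
Qed.

Lemma coupling_convex K K' (B s : R) : coupling K B -> coupling K' B ->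
  `|s| <= 1 ->
  coupling (fun i j => (K i j + K' i j) / 2 + s * ((K i j - K' i j) / 2)) B.
Proof.
move=> [Ks K0 KB] [Ks' K0' KB']; rewrite ler_norml => /andP[s1 s2].
split=> [i j|i|i]; first by rewrite (Ks i j) (Ks' i j).
  by rewrite K0 K0'; ring.
apply: (@le_trans _ _ (\sum_j ((1 + s) / 2 * `|K i j| + (1 - s) / 2 * `|K' i j|))).
  apply: ler_sum => j _.
  have -> : (K i j + K' i j) / 2 + s * ((K i j - K' i j) / 2) =
    (1 + s) / 2 * K i j + (1 - s) / 2 * K' i j by field.
  apply: le_trans (ler_normD _ _) _; rewrite !normrM.
  by rewrite (@ger0_norm _ (1 + s)) ?(@ger0_norm _ (1 - s)) ?(@ger0_norm _ 2^-1)//; lra.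
rewrite big_split/= -!mulr_sumr.
by have := KB i; have := KB' i; nra.
Qed.

(** Strong convexity of the log-partition function: on the segment between the two
    couplings the row sums stay bounded by [B], so [energy_variance] bounds the
    second derivative in the direction of half their difference. *)
Lemma partition_midpoint K K' (B : R) : coupling K B -> coupling K' B -> 0 <= B ->
  expR (- (21 * B)) / 8 * sqnorm (fun i j => K i j - K' i j)
    + 2 * ln (partition_function (fun i j => (K i j + K' i j) / 2)) <=
  ln (partition_function K) + ln (partition_function K').
Proof.
move=> KB KB' B0.
pose mid i j := (K i j + K' i j) / 2; pose A i j := (K i j - K' i j) / 2.
have KE x : energy K x = energy mid x + energy A x.
  rewrite -[energy A x]mul1r -energy_lin /energy; congr (_ * _).
  apply: eq_bigr => i _; congr (_ * _); apply: eq_bigr => j _.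
  by congr (_ * _); rewrite /mid /A; field.
have KE' x : energy K' x = energy mid x - energy A x.
  rewrite -mulN1r -energy_lin /energy; congr (_ * _).
  apply: eq_bigr => i _; congr (_ * _); apply: eq_bigr => j _.
  by congr (_ * _); rewrite /mid /A; field.
have -> : sqnorm (fun i j => K i j - K' i j) = 4 * sqnorm A.
  rewrite /sqnorm mulr_sumr; apply: eq_bigr => i _.
  by rewrite mulr_sumr; apply: eq_bigr => j _; rewrite /A; field.
rewrite /partition_function /gibbs.
under [X in _ <= ln X + _]eq_bigr do rewrite KE.
under [X in _ <= _ + ln X]eq_bigr do rewrite KE'.
have -> : expR (- (21 * B)) / 8 * (4 * sqnorm A) =
  expR (- (21 * B)) / 2 * sqnorm A by field.
apply: (log_partition_midpoint [ffun=> false]) => s mu s1.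
have sKB := coupling_convex K K' B s KB KB' s1.
have [As A0] : (forall i j, A i j = A j i) /\ (forall i, A i i = 0).
  case: KB KB' => Ks K0 _ [Ks' K0' _]; split => [i j|i]; rewrite /A.
    by rewrite Ks Ks'.
  by rewrite K0 K0' subrr mul0r.
have := energy_variance sKB B0 A mu As A0.
rewrite /partition_function /gibbs_sum /gibbs.
under eq_bigr do rewrite energy_lin.
by under [X in _ <= X -> _]eq_bigr do rewrite energy_lin.
Qed.

Definition log_density K x := energy K x - ln (partition_function K).

(** Where the second law has the larger density, the density of the first is at
    most the geometric mean of the two; the sum of the geometric means is
    [Z_mid / sqrt (Z * Z')]. *)
Lemma likelihood_ratio_error K K' (B : R) :
  coupling K B -> coupling K' B -> 0 <= B ->
  \sum_(x | log_density K x <= log_density K' x) expR (log_density K x) <=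
  expR (- (expR (- (21 * B)) / 16 * sqnorm (fun i j => K i j - K' i j))).
Proof.
move=> KB KB' B0; have := partition_midpoint K K' B KB KB' B0.
set S := sqnorm _; set mid := fun i j => _.
set z := ln (partition_function K); set z' := ln (partition_function K') => H.
apply: (@le_trans _ _ (\sum_x expR (- ((z + z') / 2)) * gibbs mid x)); last first.
  rewrite -mulr_sumr -[\sum_x _]lnK ?posrE ?partition_function_gt0// -expRD ler_expR.
  by rewrite -/(partition_function mid); lra.
rewrite [leRHS](bigID (fun x => log_density K x <= log_density K' x))/=.
apply: ler_wpDr; first by apply: sumr_ge0 => x _; rewrite mulr_ge0 ?expR_ge0.
apply: ler_sum => x; rewrite /log_density -/z -/z' => xle.
rewrite /gibbs -expRD ler_expR.
have -> : energy mid x = 2^-1 * energy K x + 2^-1 * energy K' x.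
  rewrite -[X in X + _]mulr1 -[X in X + _]add0r.
  have -> : mid = (fun i j => (fun i j => 0 + 2^-1 * K i j) i j + 2^-1 * K' i j).
    by apply/funext => i; apply/funext => j; rewrite /mid; field.
  rewrite 2!energy_lin mulr1.
  have -> : energy (fun _ _ : V => 0 : R) x = 0.
    rewrite /energy big1 ?mulr0// => i _; rewrite /field big1 ?mulr0// => j _.
    exact: mul0r.
  by [].
by lra.
Qed.

End Affinity.

(** * Trajectories as an Ising model on time-site pairs *)

Section Trajectories.
Context {R : realType} {n l : nat}.
Implicit Types (J : 'M[R]_n) (x : trajectory n l).

Definition stack x : {ffun 'I_l * 'I_n -> bool} := [ffun p => x p.1 p.2].

Definition consecutive (t u : 'I_l) : R := (u == t.+1 :> nat)%:R.

(** The sign turns the weights [exp (- energy)] of the model into [exp energy], and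
    [J1] is shared equally between the two orders of a pair of consecutive times,
    which makes the coupling symmetric. *)
Definition trajectory_coupling J0 J1 (p q : 'I_l * 'I_n) : R :=
  - ((p.1 == q.1)%:R * J0 p.2 q.2 +
     (consecutive p.1 q.1 + consecutive q.1 p.1) / 2 * J1 p.2 q.2).

Lemma sum_stack (F : {ffun 'I_l * 'I_n -> bool} -> R) (P : pred _) :
  \sum_(x : trajectory n l | P (stack x)) F (stack x) = \sum_(y | P y) F y.
Proof.
rewrite [RHS](reindex stack)//.
exists (fun y : {ffun 'I_l * 'I_n -> bool} =>
  [ffun t => [ffun i => y (t, i)]] : trajectory n l) => [x _|y _].
  by apply/ffunP => t; apply/ffunP => i; rewrite !ffunE.
by apply/ffunP => -[t i]; rewrite !ffunE.
Qed.

Lemma bilin_sum J s s' : bilin J (spins R s) (spins R s') =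
  \sum_(i < n) \sum_(j < n) J i j * ((-1) ^+ s i * (-1) ^+ s' j).
Proof.
rewrite /bilin -mulmxA mxE; apply: eq_bigr => i _.
rewrite !mxE mulr_sumr; apply: eq_bigr => j _.
by rewrite !mxE; ring.
Qed.

Lemma sum_consecutive (f : 'I_l -> 'I_l -> R) :
  \sum_t \sum_u consecutive t u * f t u =
  \sum_(t < l) \sum_(u < l | u == t.+1 :> nat) f t u.
Proof.
apply: eq_bigr => t _; rewrite [RHS]big_mkcond; apply: eq_bigr => u _.
by rewrite /consecutive; case: (_ == _); rewrite ?mul1r ?mul0r.
Qed.

Definition exponent J0 J1 x : R :=
  - (2^-1 * \sum_(t < l) bilin J0 (spins R (x t)) (spins R (x t)) +
     2^-1 * \sum_(t < l) \sum_(u < l | u == t.+1 :> nat)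
              bilin J1 (spins R (x t)) (spins R (x u))).

Lemma ising_weight_exponent J0 J1 x : ising_weight J0 J1 x = expR (exponent J0 J1 x).
Proof.
rewrite /ising_weight -expR_sum; under [X in _ * X]eq_bigr do rewrite -expR_sum.
rewrite -expR_sum -expRD; congr expR; rewrite /exponent opprD !mulr_sumr -!sumrN.
congr (_ + _); apply: eq_bigr => t _; first by rewrite mulNr mulrC.
by rewrite mulr_sumr -sumrN; apply: eq_bigr => u _; rewrite mulNr mulrC.
Qed.

Lemma bilinC J s s' : J^T = J -> bilin J (spins R s) (spins R s') =
  bilin J (spins R s') (spins R s).
Proof.
move=> JT; rewrite !bilin_sum exchange_big; apply: eq_bigr => i _.
by apply: eq_bigr => j _; rewrite -{1}JT mxE; ring.
Qed.

Lemma energy_stack J0 J1 x : J1^T = J1 ->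
  energy (trajectory_coupling J0 J1) (stack x) = exponent J0 J1 x.
Proof.
move=> JT; rewrite /energy /exponent -mulrDr -mulrN; congr (_ * _).
pose b J t u := bilin J (spins R (x t)) (spins R (x u)).
transitivity (- \sum_t \sum_u ((u == t)%:R * b J0 t u
    + 2^-1 * (consecutive t u * b J1 t u) + 2^-1 * (consecutive u t * b J1 t u))).
  rewrite -sumrN sum_prod.
  apply: eq_bigr => t _.
  transitivity (\sum_i \sum_u \sum_j spin (stack x) (t, i) *
      (trajectory_coupling J0 J1 (t, i) (u, j) * spin (stack x) (u, j))).
    by apply: eq_bigr => i _; rewrite /field mulr_sumr sum_prod.
  rewrite exchange_big/= -sumrN; apply: eq_bigr => u _.
  rewrite /b !bilin_sum !mulr_sumr -!big_split/= -sumrN; apply: eq_bigr => i _.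
  rewrite !mulr_sumr -!big_split/= -sumrN; apply: eq_bigr => j _.
  by rewrite /trajectory_coupling /spin /stack !ffunE/= (eq_sym u t); field.
congr (- _).
under eq_bigr do rewrite 2!big_split/= sum_indicator -2!mulr_sumr.
rewrite 2!big_split/= -2!mulr_sumr -sum_consecutive.
have -> : \sum_t \sum_u consecutive u t * b J1 t u =
    \sum_t \sum_u consecutive t u * b J1 t u.
  rewrite exchange_big; apply: eq_bigr => t _; apply: eq_bigr => u _.
  by rewrite /b bilinC.
by rewrite /b; field.
Qed.

Lemma sum_consecutive_next (t : 'I_l) :
  \sum_u consecutive t u = (t.+1 < l)%N%:R.
Proof.
case: ltnP => tl.
  rewrite (bigD1 (Ordinal tl))//= {1}/consecutive/= eqxx big1 ?addr0// => u ut.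
  by rewrite /consecutive; case: eqP => // e; case/eqP: ut; exact: val_inj.
rewrite big1// => u _; rewrite /consecutive.
by case: eqP => // e; have := ltn_ord u; rewrite e ltnNge tl.
Qed.

Lemma sum_consecutive_next_le1 (t : 'I_l) : \sum_u consecutive t u <= 1.
Proof. by rewrite sum_consecutive_next lern1 leq_b1. Qed.

Lemma sum_consecutive_previous_le1 (t : 'I_l) : \sum_u consecutive u t <= 1.
Proof.
case: t => -[|t] tl.
  by rewrite big1 ?ler01// => u _; rewrite /consecutive.
rewrite (bigD1 (Ordinal (ltnW tl)))//= {1}/consecutive/= eqxx big1 ?addr0// => u ut.
rewrite /consecutive/=; case: eqP => // -[e]; case/eqP: ut; exact: val_inj.
Qed.

Lemma trajectory_couplingP J0 J1 (M : R) :
  interaction_matrix J0 -> interaction_matrix J1 ->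
  norm_inf J0 <= M -> norm_inf J1 <= M ->
  coupling (trajectory_coupling J0 J1) (2 * M).
Proof.
move=> [J0T J00] [J1T J10] J0M J1M; split.
- move=> [t i] [u j]; rewrite /trajectory_coupling/= (eq_sym u t).
  by rewrite -{1}J0T -{1}J1T !mxE (addrC (consecutive t u)).
- by move=> [t i]; rewrite /trajectory_coupling/= J00 J10 !mulr0 addr0 oppr0.
move=> [t i].
apply: (@le_trans _ _ (\sum_u ((u == t)%:R * \sum_j `|J0 i j| +
    (consecutive t u + consecutive u t) / 2 * \sum_j `|J1 i j|))).
  rewrite sum_prod; apply: ler_sum => u _; rewrite !mulr_sumr -big_split/=; apply: ler_sum => j _.
  rewrite /trajectory_coupling/= normrN (eq_sym u t).
  apply: le_trans (ler_normD _ _) _; rewrite !normrM.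
  rewrite (ger0_norm (ler0n _ _)) (@ger0_norm _ (_ + _)) ?addr_ge0 ?ler0n//.
  by rewrite (@ger0_norm _ 2^-1)// invr_ge0.
rewrite big_split/= sum_indicator -!mulr_suml.
have := sum_consecutive_next_le1 t; have := sum_consecutive_previous_le1 t.
have -> : \sum_u (consecutive t u + consecutive u t) =
  \sum_u consecutive t u + \sum_u consecutive u t by rewrite big_split.
have := le_trans (norm_inf_row J0 i) J0M; have := le_trans (norm_inf_row J1 i) J1M.
have : 0 <= \sum_j `|J1 i j| by exact: sumr_ge0.
have : 0 <= \sum_u consecutive t u by apply: sumr_ge0 => u _; exact: ler0n.
have : 0 <= \sum_u consecutive u t by apply: sumr_ge0 => u _; exact: ler0n.
by nra.
Qed.

Lemma total_consecutive : (2 <= l)%N ->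
  \sum_t \sum_u consecutive t u = l%:R - 1.
Proof.
move=> l2; under eq_bigr do rewrite sum_consecutive_next.
case: l l2 => // m _; rewrite big_ord_recr/= ltnn addr0.
rewrite (eq_bigr (fun=> 1)); last by move=> i _; rewrite ltnS ltn_ord.
by rewrite sumr_const card_ord -[m.+1]addn1 natrD addrK.
Qed.

(** Each diagonal block contributes [|J0 - J0'|_F ^ 2] and each of the [2 (l - 1)]
    off-diagonal blocks a quarter of [|J1 - J1'|_F ^ 2]. *)
Lemma trajectory_coupling_dist J0 J1 J0' J1' : (2 <= l)%N ->
  l%:R / 4 * (norm_F (J0 - J0') ^+ 2 + norm_F (J1 - J1') ^+ 2) <=
  sqnorm (fun p q => trajectory_coupling J0 J1 p q - trajectory_coupling J0' J1' p q).
Proof.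
move=> l2.
have -> : sqnorm (fun p q => trajectory_coupling J0 J1 p q -
      trajectory_coupling J0' J1' p q) =
   \sum_t \sum_u ((u == t)%:R * norm_F (J0 - J0') ^+ 2 +
    4^-1 * consecutive t u * norm_F (J1 - J1') ^+ 2 +
    4^-1 * consecutive u t * norm_F (J1 - J1') ^+ 2).
  rewrite /sqnorm sum_prod; apply: eq_bigr => t _.
  transitivity (\sum_i \sum_u \sum_j (trajectory_coupling J0 J1 (t, i) (u, j) -
      trajectory_coupling J0' J1' (t, i) (u, j)) ^+ 2).
    by apply: eq_bigr => i _; rewrite sum_prod.
  rewrite exchange_big/=; apply: eq_bigr => u _; rewrite !norm_F_sqr.
  rewrite !mulr_sumr -!big_split/=; apply: eq_bigr => i _.
  rewrite !mulr_sumr -!big_split/=; apply: eq_bigr => j _.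
  rewrite /trajectory_coupling /consecutive/= !mxE (eq_sym u t).
  case: (eqVneq t u) => [<-|tu].
    by rewrite (_ : (t == t.+1 :> nat) = false); [rewrite /=; field|rewrite ltn_eqF].
  case: (eqVneq (u : nat) t.+1) => [e|_].
    by rewrite (_ : (t == u.+1 :> nat) = false); [rewrite /=; field|rewrite e ltn_eqF// ltnS leqnSn].
  by case: (_ == _) => /=; field.
under eq_bigr do rewrite 2!big_split/= sum_indicator -2!mulr_suml -2!mulr_sumr.
rewrite 2!big_split/= sumr_const card_ord -!mulr_suml -!mulr_sumr.
rewrite [X in _ + 4^-1 * X * _]exchange_big/= total_consecutive//.
rewrite -mulr_natl.
have : 2 <= l%:R :> R by rewrite ler_nat.
by have := sqr_ge0 (norm_F (J0 - J0')); have := sqr_ge0 (norm_F (J1 - J1')); nra.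
Qed.

Lemma ising_pmf_log_density J0 J1 x : J1^T = J1 ->
  ising_pmf J0 J1 x =
  expR (log_density (trajectory_coupling J0 J1) (stack x)).
Proof.
move=> JT; rewrite /ising_pmf /log_density expRB lnK ?posrE ?partition_function_gt0//.
rewrite ising_weight_exponent -energy_stack//; congr (_ / _).
rewrite /partition_function -(sum_stack _ predT); apply: eq_bigr => y _.
by rewrite ising_weight_exponent -energy_stack.
Qed.

Lemma ising_likelihood_ratio_error J0 J1 J0' J1' (M : R) :
  0 <= M -> (2 <= l)%N ->
  interaction_matrix J0 -> interaction_matrix J1 ->
  interaction_matrix J0' -> interaction_matrix J1' ->
  norm_inf J0 <= M -> norm_inf J1 <= M -> norm_inf J0' <= M -> norm_inf J1' <= M ->
  \sum_(x : trajectory n l | ising_pmf J0 J1 x <= ising_pmf J0' J1' x)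
     ising_pmf J0 J1 x <=
  expR (- (expR (- (42 * M)) / 64 *
     (l%:R * (norm_F (J0 - J0') ^+ 2 + norm_F (J1 - J1') ^+ 2)))).
Proof.
move=> M0 l2 i0 i1 i0' i1' b0 b1 b0' b1'.
have B0 : 0 <= 2 * M by lra.
have := likelihood_ratio_error _ _ _
  (trajectory_couplingP J0 J1 M i0 i1 b0 b1)
  (trajectory_couplingP J0' J1' M i0' i1' b0' b1') B0.
set S := sqnorm _; rewrite -sum_stack => H.
have -> : \sum_(x : trajectory n l | ising_pmf J0 J1 x <= ising_pmf J0' J1' x)
     ising_pmf J0 J1 x = \sum_(x : trajectory n l |
        log_density (trajectory_coupling J0 J1) (stack x)
        <= log_density (trajectory_coupling J0' J1') (stack x))
      expR (log_density (trajectory_coupling J0 J1) (stack x)).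
  case: i1 i1' => J1T _ [J1T' _].
  by apply: eq_big => x; rewrite !ising_pmf_log_density// ler_expR.
apply: le_trans H _; rewrite ler_expR lerN2.
have -> : 21 * (2 * M) = 42 * M by ring.
have := trajectory_coupling_dist J0 J1 J0' J1' l2; rewrite -/S.
by move=> /(ler_wpM2l (expR_ge0 (- (42 * M)))); lra.
Qed.

End Trajectories.

(** * Covers and perturbation of the model *)

Section Covers.
Context {R : realType} {n : nat}.

(** Bounded sets of matrices are totally bounded, with centres in the set: cut
    the range of every entry into short intervals and keep one matrix of the set
    in each nonempty cell. *)
Lemma finite_cover (JJ : set 'M[R]_n) (M eps : R) :
  0 < eps -> (0 < n)%N -> (forall J i j, JJ J -> `|J i j| <= M) ->
  exists N : {fset 'M[R]_n}, epsilon_cover (@norm_spec R n) JJ eps [set` N].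
Proof.
move=> eps0 n0 JM.
have n0R : 0 < n%:R :> R by rewrite ltr0n.
pose eta := eps / n%:R; have eta0 : 0 < eta by rewrite divr_gt0.
pose k := Num.truncn (2 * M / eta).
pose cell (J : 'M[R]_n) : 'M['I_k.+1]_n :=
  \matrix_(i, j) inord (Num.truncn ((J i j + M) / eta)).
pose rep c := xget 0 [set J | JJ J /\ cell J = c].
have repP J : JJ J -> JJ (rep (cell J)) /\ cell (rep (cell J)) = cell J.
  move=> JJJ; have : [set J' | JJ J' /\ cell J' = cell J] (rep (cell J)).
    by apply: xgetPex; exists J.
  by [].
have fin : finite_set (rep @` (cell @` JJ)).
  by apply: finite_image; exact: finite_finset.
exists (fset_set (rep @` (cell @` JJ))); rewrite fset_setK//; split.
  by move=> _ [_ [J JJJ <-] <-]; case: (repP J JJJ).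
move=> J JJJ; exists (rep (cell J)); first by exists (cell J) => //; exists J.
have [JJr cr] := repP J JJJ; set J' := rep _ in JJr cr *.
apply: le_trans (norm_spec_le_F _ _) _.
have close i j : `|J' i j - J i j| <= eta.
  have /matrixP/(_ i j) := cr; rewrite !mxE.
  have bnd (L : 'M[R]_n) : JJ L -> 0 <= (L i j + M) / eta <= 2 * M / eta.
    move=> LJ; have := JM L i j LJ; rewrite ler_norml => /andP[a b].
    rewrite divr_ge0 ?(ltW eta0) 1?ler_pM2r ?invr_gt0//=; lra.
  have lt (L : 'M[R]_n) : JJ L -> (Num.truncn ((L i j + M) / eta) < k.+1)%N.
    by move=> /bnd /andP[_ ?]; rewrite ltnS le_truncn.
  move=> /(congr1 val); rewrite /= !inordK ?lt// => e.
  have /andP[a0 _] := bnd J' JJr; have /andP[b0 _] := bnd J JJJ.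
  have /andP[a1 a2] := truncn_itv a0; have /andP[b1 b2] := truncn_itv b0.
  rewrite e in a1 a2; rewrite -natr1 in a2; rewrite -natr1 in b2.
  have : `|(J' i j + M) / eta - (J i j + M) / eta| <= 1.
    by rewrite ler_norml; apply/andP; split; lra.
  have -> : (J' i j + M) / eta - (J i j + M) / eta = (J' i j - J i j) / eta.
    by rewrite -mulrBl; congr (_ / _); ring.
  by rewrite normrM [X in _ * X]gtr0_norm ?invr_gt0// ler_pdivrMr// mul1r.
rewrite -(@ler_pXn2r _ 2) ?nnegrE ?norm_F_ge0 ?(ltW eps0)// norm_F_sqr.
apply: (@le_trans _ _ (\sum_(i < n) \sum_(j < n) eta ^+ 2)).
  apply: ler_sum => i _; apply: ler_sum => j _; rewrite !mxE.
  rewrite -real_normK ?num_real// lerXn2r ?nnegrE ?(ltW eta0)//.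
rewrite !sumr_const card_ord -mulrnA -mulr_natr natrM /eta.
rewrite le_eqVlt; apply/orP; left; apply/eqP; field.
by rewrite gt_eqF.
Qed.

Lemma covering_number_attained (JJ : set 'M[R]_n) (M eps : R) :
  0 < eps -> (0 < n)%N -> (forall J, JJ J -> norm_inf J <= M) ->
  exists2 N : {fset 'M[R]_n}, epsilon_cover (@norm_spec R n) JJ eps [set` N] &
    #|` N|%fset = covering_number JJ (@norm_spec R n) eps.
Proof.
move=> eps0 n0 JM.
have [N0 N0P] : exists N : {fset 'M[R]_n},
    epsilon_cover (@norm_spec R n) JJ eps [set` N].
  apply: (finite_cover JJ M) => // J i j /JM; apply: le_trans.
  apply: le_trans (norm_inf_row J i); rewrite (bigD1 j)//= lerDl.
  exact: sumr_ge0.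
pose P k := `[< exists2 N : {fset 'M[R]_n},
  epsilon_cover (@norm_spec R n) JJ eps [set` N] & #|` N|%fset = k >].
have exP : exists k, P k by exists #|` N0|%fset; apply/asboolP; exists N0.
have [k /asboolP kP kmin] := ex_minnP exP.
rewrite /covering_number.
set S := [set _ | _].
have : S (xget 0%N S).
  apply: xgetPex; exists k; split=> // N NP.
  by apply: kmin; apply/asboolP; exists N.
by case.
Qed.

End Covers.

Section Perturbation.
Context {R : realType} {n l : nat}.
Implicit Types (J : 'M[R]_n) (x : trajectory n l).

Lemma bilinB J J' (u v : 'cV[R]_n) : bilin (J - J') u v = bilin J u v - bilin J' u v.
Proof. by rewrite /bilin mulmxBr mulmxBl !mxE. Qed.

(** A spin vector has Euclidean norm [sqrt n], so each of the at most [2 l] bilinear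
    forms changes by at most [n * eps], and each carries a factor [1 / 2]. *)
Lemma exponent_close J0 J1 J0' J1' (eps : R) x : (0 < n)%N ->
  norm_spec (J0 - J0') <= eps -> norm_spec (J1 - J1') <= eps ->
  `|exponent J0 J1 x - exponent J0' J1' x| <= l%:R * (n%:R * eps).
Proof.
move=> n0 d0 d1.
have b J J' (t u : 'I_l) : norm_spec (J - J') <= eps ->
    `|bilin (J - J') (spins R (x t)) (spins R (x u))| <= n%:R * eps.
  by move=> d; apply: le_trans (bilin_le _ _ _ _ n0) _; rewrite ler_wpM2l ?ler0n.
have -> : exponent J0 J1 x - exponent J0' J1' x =
   - (2^-1 * \sum_(t < l) bilin (J0 - J0') (spins R (x t)) (spins R (x t)) +
      2^-1 * \sum_(t < l) \sum_u consecutive t u *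
         bilin (J1 - J1') (spins R (x t)) (spins R (x u))).
  rewrite /exponent -!sum_consecutive.
  have -> : \sum_(t < l) bilin (J0 - J0') (spins R (x t)) (spins R (x t)) =
     \sum_(t < l) bilin J0 (spins R (x t)) (spins R (x t)) -
     \sum_(t < l) bilin J0' (spins R (x t)) (spins R (x t)).
    by rewrite -sumrB; apply: eq_bigr => t _; rewrite bilinB.
  have -> : \sum_(t < l) \sum_u consecutive t u *
         bilin (J1 - J1') (spins R (x t)) (spins R (x u)) =
     \sum_(t < l) \sum_u consecutive t u * bilin J1 (spins R (x t)) (spins R (x u)) -
     \sum_(t < l) \sum_u consecutive t u * bilin J1' (spins R (x t)) (spins R (x u)).
    rewrite -sumrB; apply: eq_bigr => t _; rewrite -sumrB; apply: eq_bigr => u _.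
    by rewrite bilinB mulrBr.
  by field.
have h0 : `|\sum_(t < l) bilin (J0 - J0') (spins R (x t)) (spins R (x t))| <=
    l%:R * (n%:R * eps).
  apply: le_trans (ler_norm_sum _ _ _) _.
  rewrite -[l in l%:R]card_ord mulr_natl -sumr_const; apply: ler_sum => t _.
  exact: b.
have h1 : `|\sum_(t < l) \sum_u consecutive t u *
         bilin (J1 - J1') (spins R (x t)) (spins R (x u))| <= l%:R * (n%:R * eps).
  apply: le_trans (ler_norm_sum _ _ _) _.
  rewrite -[l in l%:R]card_ord mulr_natl -sumr_const; apply: ler_sum => t _.
  apply: le_trans (ler_norm_sum _ _ _) _.
  apply: (@le_trans _ _ (\sum_u consecutive t u * (n%:R * eps))).
    apply: ler_sum => u _; rewrite normrM ger0_norm ?ler0n//.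
    by rewrite ler_wpM2l ?ler0n ?b.
  rewrite -mulr_suml -[leRHS]mul1r ler_wpM2r ?sum_consecutive_next_le1//.
  by apply: le_trans (b _ _ t t d0).
rewrite normrN; apply: le_trans (ler_normD _ _) _; rewrite !normrM.
by rewrite (@ger0_norm _ 2^-1) ?invr_ge0//; lra.
Qed.

(** One factor [exp (l n eps)] comes from the weight and one from the
    normalization. *)
Lemma ising_pmf_close J0 J1 J0' J1' (eps : R) x : (0 < n)%N ->
  norm_spec (J0' - J0) <= eps -> norm_spec (J1' - J1) <= eps ->
  ising_pmf J0 J1 x <= expR (2 * (l%:R * (n%:R * eps))) * ising_pmf J0' J1' x.
Proof.
move=> n0 d0 d1; set e := l%:R * _.
have cl y := exponent_close J0' J1' J0 J1 eps y n0 d0 d1.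
have w0 a b (y : trajectory n l) : 0 < ising_weight a b y :> R by rewrite ising_weight_exponent expR_gt0.
have up (y : trajectory n l) : ising_weight J0 J1 y <= expR e * ising_weight J0' J1' y.
  rewrite !ising_weight_exponent -expRD ler_expR.
  by have := cl y; rewrite -/e ler_norml => /andP[]; lra.
have dn (y : trajectory n l) : ising_weight J0' J1' y <= expR e * ising_weight J0 J1 y.
  rewrite !ising_weight_exponent -expRD ler_expR.
  by have := cl y; rewrite -/e ler_norml => /andP[]; lra.
rewrite /ising_pmf; set Z := \sum_y _; set Z' := \sum_y _.
have Z0 a b : 0 < \sum_(y : trajectory n l) ising_weight a b y :> R.
  rewrite (bigD1 x)//= ltr_pwDl// sumr_ge0// => y _; exact: ltW.
have ZZ : Z' <= expR e * Z by rewrite /Z mulr_sumr; apply: ler_sum => y _.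
rewrite ler_pdivrMr ?Z0//.
have -> : 2 * e = e + e by ring.
rewrite expRD.
have -> : expR e * expR e * (ising_weight J0' J1' x / Z') * Z =
   (expR e * ising_weight J0' J1' x) * ((expR e * Z) / Z') by ring.
rewrite -[leLHS]mulr1; apply: ler_pM => //; first exact: ltW.
by rewrite ler_pdivlMr ?Z0// mul1r.
Qed.

End Perturbation.

(** * Maximum likelihood over a finite set of models *)

Lemma maximizer_exists {R : realType} {T : eqType} (f : T -> R) (s : seq T) : s != [::] ->
  exists2 v, v \in s & {in s, forall u, f u <= f v}.
Proof.
elim: s => // v s IH _; have [->|/IH[w ws wmax]] := eqVneq s [::].
  by exists v; rewrite ?mem_head// => u; rewrite inE => /eqP ->.
have [vw|wv] := leP (f v) (f w).
  exists w; first by rewrite inE ws orbT.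
  by move=> u; rewrite inE => /predU1P[->//|/wmax].
exists v; first exact: mem_head.
by move=> u; rewrite inE => /predU1P[->//|/wmax/le_trans]; apply; exact: ltW.
Qed.

Section MaximumLikelihood.
Context {R : realType} {n l : nat}.
Local Notation model := ('M[R]_n * 'M[R]_n)%type.
Implicit Types (u v : model) (x : trajectory n l) (s : seq model).

Definition sqdist u v : R := norm_F (u.1 - v.1) ^+ 2 + norm_F (u.2 - v.2) ^+ 2.

Definition admissible (M : R) u :=
  [/\ interaction_matrix u.1, interaction_matrix u.2,
      norm_inf u.1 <= M & norm_inf u.2 <= M].

Lemma ising_pmf_ge0 J0 J1 x : 0 <= ising_pmf J0 J1 x :> R.
Proof.
rewrite divr_ge0 ?sumr_ge0 ?ising_weight_exponent ?expR_ge0// => y _.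
by rewrite ising_weight_exponent expR_ge0.
Qed.

Lemma ising_pmf_sum1 (J0 J1 : 'M[R]_n) :
  \sum_(x : trajectory n l) ising_pmf J0 J1 x = 1.
Proof.
rewrite -mulr_suml mulfV// gt_eqF// (bigD1 [ffun=> [ffun=> false]])//=.
rewrite ltr_pwDl ?ising_weight_exponent ?expR_gt0// sumr_ge0// => x _.
by rewrite ising_weight_exponent expR_ge0.
Qed.

(** Union bound: if the maximizer is far from [u], then it is itself a candidate
    that is far from [u] and beats [u] in the likelihood ratio test. *)
Lemma mle_error (M r : R) s u (est : trajectory n l -> model) :
  0 <= M -> (2 <= l)%N -> u \in s -> {in s, forall v, admissible M v} ->
  (forall x, est x \in s) ->
  (forall x, {in s, forall v,
     ising_pmf v.1 v.2 x <= ising_pmf (est x).1 (est x).2 x}) ->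
  \sum_(x | r < sqdist u (est x)) ising_pmf u.1 u.2 x <=
  (size s)%:R * expR (- (expR (- (42 * M)) / 64 * (l%:R * r))).
Proof.
move=> M0 l2 us adm es emax; set e := expR (- _).
apply: (@le_trans _ _ (\sum_x \sum_(v <- s | (r < sqdist u v) &&
    (ising_pmf u.1 u.2 x <= ising_pmf v.1 v.2 x)) ising_pmf u.1 u.2 x)).
  rewrite big_mkcond/=; apply: ler_sum => x _; case: ifP => [far|_]; last first.
    by apply: sumr_ge0 => v _; exact: ising_pmf_ge0.
  rewrite big_mkcond (big_rem (est x))//= far emax//= lerDl.
  by apply: sumr_ge0 => v _; case: ifP => // _; exact: ising_pmf_ge0.
rewrite (exchange_big_dep xpredT)//= mulr_natl -[size s]count_predT.
rewrite -iter_addr_0 -big_const_seq -/(\sum_(v <- s) e).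
rewrite [leLHS]big_seq [leRHS]big_seq; apply: ler_sum => v vs.
have [far|near] := ltP r (sqdist u v); last first.
  by rewrite big1 ?expR_ge0// => x; rewrite ltNge near.
have [? ? ? ?] := adm u us; have [? ? ? ?] := adm v vs.
rewrite (eq_bigl (fun x => ising_pmf u.1 u.2 x <= ising_pmf v.1 v.2 x))//.
apply: le_trans (ising_likelihood_ratio_error _ _ _ _ M _ _ _ _ _ _ _ _ _ _) _ => //.
rewrite ler_expR lerN2 ler_wpM2l ?divr_ge0 ?expR_ge0//.
by rewrite ler_wpM2l ?ler0n ?ltW.
Qed.

End MaximumLikelihood.

(** * The rate *)

(** From [1 - 1/6 <= exp (- 1/6)] one gets [exp 1 <= (6/5) ^ 6 < 3]. *)
Lemma expR1_lt3 {R : realType} : expR 1 < 3 :> R.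
Proof.
have h : expR (- 6^-1) * expR 6^-1 = 1 :> R by rewrite -expRD addNr expR0.
have h1 : 5 / 6 <= expR (- 6^-1) :> R.
  by apply: le_trans (expR_ge1Dx _); lra.
have h2 : expR 6^-1 <= 6 / 5 :> R.
  have := expR_gt0 (6^-1 : R); move: (expR _) (expR _) h h1 => a b; nra.
have -> : expR 1 = expR 6^-1 ^+ 6 :> R.
  by rewrite -expRM_natl; congr expR; field.
apply: (@le_lt_trans _ _ ((6 / 5) ^+ 6)).
  by rewrite lerXn2r ?nnegrE ?expR_ge0 ?divr_ge0.
by rewrite !exprS expr0; lra.
Qed.

(** This positive lower bound for [ln (ln n)] is what absorbs additive constants into
    the rate. *)
Lemma lnln3_gt0 {R : realType} : 0 < ln (ln 3) :> R.
Proof.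
apply: ln_gt0; rewrite -ltr_expR lnK ?posrE ?ltr0n//; exact: expR1_lt3.
Qed.

Lemma le_lnln3 {R : realType} (n : nat) : (3 <= n)%N ->
  ln (ln 3) <= ln (ln n%:R) :> R.
Proof.
move=> n3; have n0 : 0 < n%:R :> R by rewrite ltr0n (leq_trans _ n3).
have l3 : 0 < ln 3 :> R by apply: ln_gt0; rewrite ltr1n.
have ln3 : ln 3 <= ln n%:R :> R by rewrite ler_ln ?posrE ?ler_nat.
by rewrite ler_ln ?posrE// (lt_le_trans l3).
Qed.

(** The first term pays for the distance [1 / sqrt l] to the cover, the second for
    the radius of the union bound. *)
Definition rate_constant {R : realType} : R :=
  Num.sqrt (ln (ln 3))^-1 + 8 * Num.sqrt (1 + 2 / ln (ln 3)).

Lemma rate_bound {R : realType} (M L d S T : R) : 0 < M -> 0 < L ->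
  ln (ln 3) <= S -> T <= (1 + 2 / ln (ln 3)) * S ->
  d <= (Num.sqrt L)^-1 + Num.sqrt (64 * expR (42 * M) * T / L) ->
  d <= rate_constant * expR (21 * M) / Num.sqrt L * Num.sqrt S.
Proof.
move=> M0 L0 s0S TS /le_trans; apply.
have s00 : 0 < ln (ln 3) :> R := lnln3_gt0; set s0 := ln _ in s00 s0S TS *.
set a := 1 + 2 / s0 in TS *.
have a0 : 0 <= a by rewrite addr_ge0// divr_ge0 ?(ltW s00).
have S0 : 0 <= S := le_trans (ltW s00) s0S.
have e0 := expR_gt0 (21 * M).
have e1 : 1 <= expR (21 * M) by rewrite -[leLHS]expR0 ler_expR mulr_ge0// ltW.
have sL : 0 < (Num.sqrt L)^-1 by rewrite invr_gt0 sqrtr_gt0.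
have h1 : 1 <= Num.sqrt s0^-1 * Num.sqrt S.
  rewrite -sqrtrM ?invr_ge0 ?(ltW s00)// -[leLHS]sqrtr1.
  rewrite ler_sqrt ?mulr_ge0 ?invr_ge0 ?(ltW s00)//.
  by rewrite mulrC ler_pdivlMr// mul1r.
have h2 : Num.sqrt (64 * expR (42 * M) * T / L) <=
    8 * Num.sqrt a * expR (21 * M) * (Num.sqrt L)^-1 * Num.sqrt S.
  have -> : 8 * Num.sqrt a * expR (21 * M) * (Num.sqrt L)^-1 * Num.sqrt S =
     Num.sqrt ((8 * expR (21 * M)) ^+ 2 * (a * S) / L).
    rewrite -[_ ^+ 2 * _ / _]mulrA sqrtrM ?sqr_ge0// sqrtr_sqr.
    rewrite [Num.sqrt (a * S / L)]sqrtrM ?mulr_ge0// [Num.sqrt (a * S)]sqrtrM//.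
    rewrite sqrtrV ?(ltW L0)//.
    by rewrite ger0_norm ?mulr_ge0 ?(ltW e0)//; ring.
  rewrite ler_sqrt; last first.
    by rewrite divr_ge0 ?(ltW L0)// mulr_ge0 ?sqr_ge0 ?mulr_ge0.
  rewrite ler_wpM2r ?invr_ge0 ?(ltW L0)//.
  have -> : (8 * expR (21 * M)) ^+ 2 = 64 * expR (42 * M).
    have -> : 42 * M = 21 * M + 21 * M by ring.
    by rewrite expRD; ring.
  by rewrite ler_wpM2l ?mulr_ge0 ?expR_ge0.
have h3 : (Num.sqrt L)^-1 <=
    Num.sqrt s0^-1 * expR (21 * M) * (Num.sqrt L)^-1 * Num.sqrt S.
  have -> : Num.sqrt s0^-1 * expR (21 * M) * (Num.sqrt L)^-1 * Num.sqrt S =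
    (expR (21 * M) * (Num.sqrt s0^-1 * Num.sqrt S)) * (Num.sqrt L)^-1 by ring.
  by rewrite -[leLHS]mul1r ler_wpM2r ?(ltW sL)//; nra.
by rewrite /rate_constant -/s0 -/a; lra.
Qed.

Theorem corollary7 (R : realType) :
  exists2 C : R -> R, singly_exponential C &
  forall (M : R) (n l : nat) (delta : R) (JJ0 JJ1 : set 'M[R]_n),
    0 < M -> (3 <= n)%N -> (2 <= l)%N -> 0 < delta < 1 ->
    (forall J, JJ0 J -> interaction_matrix J /\ norm_inf J <= M) ->
    (forall J, JJ1 J -> interaction_matrix J /\ norm_inf J <= M) ->
    exists Jhat : trajectory n l -> 'M[R]_n * 'M[R]_n,
      forall J0 J1 : 'M[R]_n, JJ0 J0 -> JJ1 J1 ->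
        let N0 := covering_number JJ0 (@norm_spec R n) (n%:R * l%:R)^-1 in
        let N1 := covering_number JJ1 (@norm_spec R n) (n%:R * l%:R)^-1 in
        let bound := C M / Num.sqrt l%:R *
          Num.sqrt (ln N0%:R + ln N1%:R + ln (ln n%:R) + ln (1 / delta)) in
        1 - delta <= ising_Pr J0 J1 (fun x =>
          (norm_F (J0 - (Jhat x).1) <= bound) &&
          (norm_F (J1 - (Jhat x).2) <= bound)).
Proof.
have rate_gt0 : 0 < @rate_constant R.
  have s0 := @lnln3_gt0 R.
  rewrite ltr_pwDl ?sqrtr_gt0 ?invr_gt0// mulr_ge0// sqrtr_ge0//.
exists (fun M => rate_constant * expR (21 * M)); first by exists rate_constant, 21.
move=> M n l delta JJ0 JJ1 M0 n3 l2 /andP[delta0 delta1] JJ0M JJ1M.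
have n0 : (0 < n)%N by apply: leq_trans n3.
have n0R : 0 < n%:R :> R by rewrite ltr0n.
have l0R : 0 < l%:R :> R by rewrite ltr0n (leq_trans _ l2).
set eps := (n%:R * l%:R)^-1; have eps0 : 0 < eps by rewrite invr_gt0 mulr_gt0.
have [F0 [F0J F0c] F0N] := covering_number_attained JJ0 M eps eps0 n0
  (fun J h => (JJ0M J h).2).
have [F1 [F1J F1c] F1N] := covering_number_attained JJ1 M eps eps0 n0
  (fun J h => (JJ1M J h).2).
rewrite -F0N -F1N.
pose s := [seq (a, b) | a <- enum_fset F0, b <- enum_fset F1].
pose mle (x : trajectory n l) := xget (0, 0) [set v | v \in s /\
  {in s, forall v', ising_pmf v'.1 v'.2 x <= ising_pmf v.1 v.2 x}].
exists mle => J0 J1 J0J J1J; lazy zeta.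
set N0 := #|` F0|%fset; set N1 := #|` F1|%fset; set bound := _ / _ * _.
have [u0 u0F d0] := F0c J0 J0J; have [u1 u1F d1] := F1c J1 J1J.
pose u := (u0, u1); have us : u \in s by apply: allpairs_f.
have mleP x : mle x \in s /\ {in s, forall v,
    ising_pmf v.1 v.2 x <= ising_pmf (mle x).1 (mle x).2 x}.
  apply: (@xgetPex _ (0, 0) [set v | v \in s /\
    {in s, forall v', ising_pmf v'.1 v'.2 x <= ising_pmf v.1 v.2 x}]).
  have [|v vs vmax] := maximizer_exists (fun v : _ * _ => ising_pmf v.1 v.2 x) s.
    by apply/eqP => s0; rewrite s0 in us.
  by exists v.
have adm : {in s, forall v, admissible M v}.
  move=> _ /allpairsP[[a b] /= [aF bF ->]].
  by have [? ?] := JJ0M a (F0J a aF); have [? ?] := JJ1M b (F1J b bF).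
have N0_gt0 : 0 < N0%:R :> R.
  by rewrite ltr0n /N0 cardfs_gt0; apply/fset0Pn; exists u0.
have N1_gt0 : 0 < N1%:R :> R.
  by rewrite ltr0n /N1 cardfs_gt0; apply/fset0Pn; exists u1.
(* The 2 accounts for the factor e ^ 2 lost by moving the truth into the covers,
   and r is the squared radius at which the union bound equals delta. *)
pose T := 2 + ln N0%:R + ln N1%:R + ln (1 / delta).
have lnN0 : 0 <= ln N0%:R :> R by apply: ln_ge0; rewrite ler1n -(ltr0n R).
have lnN1 : 0 <= ln N1%:R :> R by apply: ln_ge0; rewrite ler1n -(ltr0n R).
have lnd : 0 <= ln (1 / delta).
  by apply: ln_ge0; rewrite ler_pdivlMr// mul1r ltW.
have T0 : 0 <= T by rewrite /T; lra.
pose r := 64 * expR (42 * M) * T / l%:R.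
have r0 : 0 <= r by rewrite divr_ge0 ?ler0n// mulr_ge0// mulr_ge0 ?expR_ge0.
have close (A A0 A1 : 'M[R]_n) : norm_spec (A0 - A) <= eps ->
    norm_F (A0 - A1) ^+ 2 <= r -> norm_F (A - A1) <= bound.
  move=> dA dr; apply: (rate_bound M l%:R _ _ T) => //.
  - by have := @le_lnln3 R n n3; rewrite /N0 /N1; lra.
  - have := @le_lnln3 R n n3; have := @lnln3_gt0 R; rewrite /T.
    move: (ln (ln 3)) (ln (ln n%:R)) => s0 sn s00 s0n.
    have : 2 <= 2 / s0 * (ln N0%:R + ln N1%:R + sn + ln (1 / delta)).
      rewrite mulrAC ler_pdivlMr// ler_wpM2l//; lra.
    by lra.
  have -> : A - A1 = - 1 *: (A0 - A) + (A0 - A1).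
    by rewrite scaleN1r opprB addrA subrK.
  apply: le_trans (norm_F_triangle _ _ _ _) _; apply: lerD.
    rewrite norm_FZ normrN1 mul1r; apply: le_trans (norm_F_le_spec _ _) _.
    apply: le_trans (ler_wpM2l (sqrtr_ge0 _) dA) _.
    have sn : 0 < Num.sqrt n%:R :> R by rewrite sqrtr_gt0.
    have sl : 0 < Num.sqrt l%:R :> R by rewrite sqrtr_gt0.
    have n1 : 1 <= Num.sqrt n%:R :> R by rewrite -[leLHS]sqrtr1 ler_sqrt ?ler1n.
    have l1 : 1 <= Num.sqrt l%:R :> R.
      by rewrite -[leLHS]sqrtr1 ler_sqrt ?ler1n ?(leq_trans _ l2).
    rewrite /eps -{2}(@sqr_sqrtr R n%:R) ?ler0n// -{1}(@sqr_sqrtr R l%:R) ?ler0n//.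
    move: (Num.sqrt n%:R) (Num.sqrt l%:R) sn sl n1 l1 => a b a0 b0 a1 b1.
    have -> : a / (a ^+ 2 * b ^+ 2) = b^-1 * (a * b)^-1.
      by field; rewrite !gt_eqF.
    rewrite -[leRHS]mulr1 ler_wpM2l ?invr_ge0 ?(ltW b0)// invf_le1 ?mulr_gt0//.
    by nra.
  by rewrite -[leLHS]ger0_norm ?norm_F_ge0// -sqrtr_sqr ler_sqrt.
rewrite -[X in X - delta](@ising_pmf_sum1 R n l J0 J1) /ising_Pr.
rewrite (bigID (fun x => (norm_F (J0 - (mle x).1) <= bound) &&
  (norm_F (J1 - (mle x).2) <= bound)))/=.
rewrite lerBlDr lerD2l.
apply: (@le_trans _ _ (\sum_(x | r < sqdist u (mle x)) ising_pmf J0 J1 x)).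
  rewrite [leRHS]big_mkcond [leLHS]big_mkcond; apply: ler_sum => x _.
  case: ltP => [_|near]; first by case: ifP => // _; exact: ising_pmf_ge0.
  rewrite ifN// negbK.
  have := sqr_ge0 (norm_F (u0 - (mle x).1)).
  have := sqr_ge0 (norm_F (u1 - (mle x).2)).
  move: near; rewrite /sqdist/= => near g1 g0.
  by rewrite (close _ u0)// ?(close _ u1)//; lra.
have le2 (x : trajectory n l) : ising_pmf J0 J1 x <= expR 2 * ising_pmf u.1 u.2 x.
  have := @ising_pmf_close R n l J0 J1 u0 u1 eps x n0.
  have -> : l%:R * (n%:R * eps) = 1.
    by rewrite /eps; field; rewrite !gt_eqF.
  by rewrite mulr1; exact.
apply: (@le_trans _ _ (expR 2 * ((size s)%:R * expR (- (expR (- (42 * M)) / 64 * (l%:R * r)))))).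
  apply: le_trans (ler_wpM2l (expR_ge0 2) (mle_error M r s u mle (ltW M0) l2 us adm
    (fun x => (mleP x).1) (fun x => (mleP x).2))).
  by rewrite mulr_sumr; apply: ler_sum => x _; exact: le2.
have -> : expR (- (42 * M)) / 64 * (l%:R * r) = T.
  rewrite /r expRN; field.
  by rewrite !gt_eqF// expR_gt0.
have -> : (size s)%:R = N0%:R * N1%:R :> R by rewrite size_allpairs natrM.
rewrite /T -{1}(lnK (_ : N0%:R \is Num.pos)) ?posrE// -{1}(lnK (_ : N1%:R \is Num.pos)) ?posrE//.
rewrite -!expRD -[leRHS]lnK ?posrE// ler_expR div1r lnV ?posrE//.
by lra.
Qed.
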